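(* Let $G$ be a finite graph with crossing number $\nu(G)\le 3$ and clique number $\omega(G)\le 5$. Then $G$ has a proper $5$-coloring.
   Context: Graphs are finite and simple. A drawing of a graph in the plane $\mathbb{R}^2$ represents vertices by distinct points and edges by curves joining the points of their ends, such that no three edges cross at a common point. The crossing number $\nu(G)$ is the minimum number of crossings over all drawings of $G$. The clique number $\omega(G)$ is the largest $n$ such that the complete graph $K_n$ is a subgraph of $G$. A proper coloring assigns colors to vertices so that adjacent vertices receive distinct colors. *)

(* Defs.v *)
From Stdlib Require Import Reals List.
From mathcomp Require Import all_boot.
Set Implicit Arguments. Unset Strict Implicit. Unset Printing Implicit Defensive.

Definition point := (R * R)%type.

Definition on_interior (g : R -> point) (p : point) : Prop :=
  exists t : R, (Rlt R0 t /\ Rlt t R1) /\ g t = p.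

Definition same_edge (T : finType) (a b c d : T) : Prop :=
  (a = c /\ b = d) \/ (a = d /\ b = c).

(* A drawing of the simple graph (T,e): vertices are distinct points pos x;
   the edge xy is drawn as the curve g x y restricted to [0,1] (g y x is the
   same curve traversed backwards): a continuous, injective arc from pos x to
   pos y whose interior avoids all vertex points; no point lies in the
   interior of three distinct edges. *)
Definition is_drawing (T : finType) (e : rel T) (pos : T -> point)
    (g : T -> T -> R -> point) : Prop :=
  injective pos /\
  (forall x y, e x y ->
     continuity (fun t => fst (g x y t)) /\
     continuity (fun t => snd (g x y t)) /\
     (forall s t, (Rle R0 s /\ Rle s R1) -> (Rle R0 t /\ Rle t R1) -> g x y s = g x y t -> s = t) /\
     g x y R0 = pos x /\ g x y R1 = pos y /\
     (forall t, (Rle R0 t /\ Rle t R1) -> g y x t = g x y (Rminus R1 t)) /\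
     (forall t z, (Rlt R0 t /\ Rlt t R1) -> g x y t <> pos z)) /\
  (forall p a1 b1 a2 b2 a3 b3,
     e a1 b1 -> e a2 b2 -> e a3 b3 ->
     on_interior (g a1 b1) p -> on_interior (g a2 b2) p -> on_interior (g a3 b3) p ->
     same_edge a1 b1 a2 b2 \/ same_edge a1 b1 a3 b3 \/ same_edge a2 b2 a3 b3).

Definition is_crossing (T : finType) (e : rel T) (g : T -> T -> R -> point)
    (p : point) : Prop :=
  exists a b c d, e a b /\ e c d /\ ~ same_edge a b c d /\
    on_interior (g a b) p /\ on_interior (g c d) p.

Definition crossing_number_le (T : finType) (e : rel T) (k : nat) : Prop :=
  exists pos g, is_drawing e pos g /\
    exists l : list point, (List.length l <= k)%coq_nat /\
      forall p, is_crossing e g p -> List.In p l.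

Definition clique_number_le (T : finType) (e : rel T) (k : nat) : Prop :=
  forall f : 'I_k.+1 -> T, injective f ->
    ~ (forall i j, i != j -> e (f i) (f j)).

Definition colorable (T : finType) (e : rel T) (k : nat) : Prop :=
  exists c : T -> 'I_k, forall x y, e x y -> c x != c y.

(* Main.v *)
Require Import Defs.
From Stdlib Require Import Reals List Lra Lia Bool Ring ClassicalEpsilon.
From mathcomp Require Import all_boot perm zify_ssreflect.
Set Implicit Arguments. Unset Strict Implicit. Unset Printing Implicit Defensive.

(** Take a vertex set S that is minimal without a 5-coloring.  All degrees in S
    are at least 5.  If v has degree 5, color S - v; each two neighbors of v are
    joined by a Kempe chain, so that v, its neighbors and the chains form a map
    of K6 to the plane in which disjoint edges of K6 use disjoint vertices of G
    and every edge of G is used by one edge of K6 at most.  Each of the six K5's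
    of K6 has two disjoint edges with a common point, that is, contains one of
    the three crossings, whose four ends have different colors; so a crossing
    serves at most two K5's.  Hence each crossing serves exactly two, and v is an
    end of exactly two crossings.

    Deleting an edge at each crossing gives a planar graph, so G[S] has at most
    3|S| - 3 edges and at least 6 vertices of degree 5.  As the three crossings
    have 12 ends, there are exactly 6 such vertices, and exactly 3|S| - 3 edges.
    Now let ac and bd cross, with a and b not adjacent.  Delete bd and an edge at
    each of the two other crossings, and join a to b along ac and db: the
    resulting planar graph has 3|S| - 5 edges, which is too many.  So the ends of
    each crossing form a K4, and, any two of the 6 vertices of degree 5 being
    ends of a common crossing, these vertices form a K6.

    Planarity enters only through the existence of a drawing whose disjoint edges
    do not meet, and this property is preserved by contracting an edge.  Mader's
    proof that 3n - 5 edges force a K5 minor therefore gives the edge bound from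
    the single fact that K5 has no such drawing. *)

(** * Maps of K5 to the plane *)

Section PlanePaths.
Local Open Scope R_scope.

Definition planar_path (g : R -> point) : Prop :=
  continuity (fun t => fst (g t)) /\ continuity (fun t => snd (g t)).

(** Paths may cross themselves, so that arcs and chains of arcs can be concatenated freely. *)
Definition joined (A : point -> Prop) (p q : point) : Prop :=
  exists g, planar_path g /\ g 0 = p /\ g 1 = q /\
    forall t, 0 <= t <= 1 -> A (g t).

Lemma continuity_affine (a b : R) : continuity (fun t => a * t + b).
Proof. by reg. Qed.

Lemma planar_path_comp (g : R -> point) (f : R -> R) :
  planar_path g -> continuity f -> planar_path (fun t => g (f t)).
Proof.
by move=> [c1 c2] cf; split; [exact: (continuity_comp f _ cf c1)|
  exact: (continuity_comp f _ cf c2)].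
Qed.

Lemma joined_sub (A B : point -> Prop) p q :
  (forall x, A x -> B x) -> joined A p q -> joined B p q.
Proof.
by move=> sAB [g [cg [g0 [g1 gA]]]]; exists g; split=> //; split=> //; split=> // t /gA/sAB.
Qed.

Lemma joined_sym (A : point -> Prop) p q : joined A p q -> joined A q p.
Proof.
move=> [g [cg [g0 [g1 gA]]]]; exists (fun t => g ((-1) * t + 1)); split.
  exact: planar_path_comp cg (continuity_affine _ _).
split; first by rewrite -g1; congr g; ring.
split; first by rewrite -g0; congr g; ring.
by move=> t ht; apply: gA; lra.
Qed.

Lemma joined_subpath (g : R -> point) (s t : R) :
  planar_path g ->
  joined (fun q => exists u, Rmin s t <= u <= Rmax s t /\ g u = q) (g s) (g t).
Proof.
move=> cg; exists (fun u => g ((t - s) * u + s)); split.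
  exact: planar_path_comp cg (continuity_affine _ _).
split; first by congr g; ring.
split; first by congr g; ring.
move=> u hu; exists ((t - s) * u + s); split=> //.
by rewrite /Rmin /Rmax; case: Rle_dec => h; nra.
Qed.

(** This is min(max(t, 0), 1), written with absolute values so that [reg] proves its continuity. *)
Definition clamp (t : R) : R := (Rabs t - Rabs (t - 1) + 1) / 2.

Lemma continuity_clamp : continuity clamp.
Proof. by rewrite /clamp; reg. Qed.

Lemma clamp_le0 t : t <= 0 -> clamp t = 0.
Proof. by move=> h; rewrite /clamp !Rabs_left1; lra. Qed.

Lemma clamp_id t : 0 <= t <= 1 -> clamp t = t.
Proof. by move=> h; rewrite /clamp Rabs_pos_eq ?Rabs_left1; lra. Qed.

Lemma clamp_ge1 t : 1 <= t -> clamp t = 1.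
Proof. by move=> h; rewrite /clamp !Rabs_pos_eq; lra. Qed.

(* At each time one of the two clamped paths rests at the common end [q],
   so the sum minus [q] runs through one path after the other. *)
Lemma joined_trans (A : point -> Prop) p q r :
  joined A p q -> joined A q r -> joined A p r.
Proof.
move=> [g [cg [g0 [g1 gA]]]] [h [ch [h0 [h1 hA]]]].
pose f t := g (clamp (2 * t + 0)); pose k t := h (clamp (2 * t + (-1))).
have cf : planar_path f.
  apply: planar_path_comp cg _; exact: continuity_comp (continuity_affine _ _) continuity_clamp.
have ck : planar_path k.
  apply: planar_path_comp ch _; exact: continuity_comp (continuity_affine _ _) continuity_clamp.
exists (fun t => (fst (f t) + fst (k t) - fst q, snd (f t) + snd (k t) - snd q)).
have E1 t : t <= 1/2 -> k t = q.
  by move=> ht; rewrite /k clamp_le0 //; lra.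
have E2 t : 1/2 <= t -> f t = q.
  by move=> ht; rewrite /f clamp_ge1 //; lra.
split; first split => /=.
- apply: continuity_minus; last exact: continuity_const.
  by apply: continuity_plus; [case: cf|case: ck].
- apply: continuity_minus; last exact: continuity_const.
  by apply: continuity_plus; [case: cf|case: ck].
have F1 t : t <= 1/2 -> (fst (f t) + fst (k t) - fst q, snd (f t) + snd (k t) - snd q) = f t.
  by move=> ht; rewrite E1 // [RHS]surjective_pairing; congr pair; ring.
have F2 t : 1/2 <= t -> (fst (f t) + fst (k t) - fst q, snd (f t) + snd (k t) - snd q) = k t.
  by move=> ht; rewrite E2 // [RHS]surjective_pairing; congr pair; ring.
split; first by rewrite F1 ?/f; [rewrite clamp_le0 //; lra|lra].
split; first by rewrite F2 ?/k; [rewrite clamp_ge1 //; lra|lra].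
move=> t ht; case: (Rle_dec t (1/2)) => h2.
  by rewrite F1 // /f; apply: gA; rewrite clamp_id; lra.
by rewrite F2 ?/k; [apply: hA; rewrite clamp_id; lra|lra].
Qed.

(** Compactness of the unit square, one variable at a time: the sum of the coordinate distances is
    minimized over [t], and then the minimum, being continuous in [s], over [s]. Half of the result
    serves as [d], for one of two summands is at least half of their sum. *)
Lemma disjoint_paths_apart (g h : R -> point) :
  planar_path g -> planar_path h ->
  (forall s t, 0 <= s <= 1 -> 0 <= t <= 1 -> g s <> h t) ->
  exists d, 0 < d /\ forall s t, 0 <= s <= 1 -> 0 <= t <= 1 ->
    d <= Rabs (fst (g s) - fst (h t)) \/ d <= Rabs (snd (g s) - snd (h t)).
Proof.
move=> [cg1 cg2] [ch1 ch2] gh.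
pose f s t := Rabs (fst (g s) - fst (h t)) + Rabs (snd (g s) - snd (h t)).
have cf s : continuity (f s).
  apply: continuity_plus.
    apply: (continuity_comp (fun t => fst (g s) - fst (h t)) Rabs); last exact: Rcontinuity_abs.
    by apply: continuity_minus => //; exact: continuity_const.
  apply: (continuity_comp (fun t => snd (g s) - snd (h t)) Rabs); last exact: Rcontinuity_abs.
  by apply: continuity_minus => //; exact: continuity_const.
have fpos s t : 0 <= s <= 1 -> 0 <= t <= 1 -> 0 < f s t.
  move=> hs ht; have ne := gh _ _ hs ht.
  have [p1 p2] := (Rabs_pos (fst (g s) - fst (h t)), Rabs_pos (snd (g s) - snd (h t))).
  rewrite /f; case: (Req_dec (fst (g s)) (fst (h t))) => e1; last first.
    by have := Rabs_pos_lt (fst (g s) - fst (h t)); lra.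
  case: (Req_dec (snd (g s)) (snd (h t))) => e2; last first.
    by have := Rabs_pos_lt (snd (g s) - snd (h t)); lra.
  by case: ne; rewrite (surjective_pairing (g s)) e1 e2 -surjective_pairing.
have le01 : 0 <= 1 by lra.
have minf s : exists t, (forall c, 0 <= c <= 1 -> f s t <= f s c) /\ 0 <= t <= 1.
  by apply: continuity_ab_min => // c _; apply: cf.
pose m s := proj1_sig (constructive_indefinite_description _ (minf s)).
have mP s : (forall c, 0 <= c <= 1 -> f s (m s) <= f s c) /\ 0 <= m s <= 1.
  by rewrite /m; case: constructive_indefinite_description.
have lip s s' t : f s t <= f s' t + Rabs (fst (g s) - fst (g s')) + Rabs (snd (g s) - snd (g s')).
  have := Rabs_triang (fst (g s) - fst (g s')) (fst (g s') - fst (h t)).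
  have := Rabs_triang (snd (g s) - snd (g s')) (snd (g s') - snd (h t)).
  rewrite /f; replace (fst (g s) - fst (g s') + (fst (g s') - fst (h t))) with (fst (g s) - fst (h t)) by ring.
  by replace (snd (g s) - snd (g s') + (snd (g s') - snd (h t))) with (snd (g s) - snd (h t)) by ring; lra.
(* Comparing both values at the minimizer for [s'] shows that the minimum varies no more than [g s]
   does. *)
have mlip s s' : f s (m s) <= f s' (m s') + Rabs (fst (g s) - fst (g s')) + Rabs (snd (g s) - snd (g s')).
  by have := lip s s' (m s'); have := (mP s).1 _ (mP s').2; lra.
have cm : continuity (fun s => f s (m s)).
  move=> s e he.
  have [d1 [hd1 H1]] := cg1 s (e/2) ltac:(lra).
  have [d2 [hd2 H2]] := cg2 s (e/2) ltac:(lra).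
  exists (Rmin d1 d2); split; first by apply: Rmin_pos.
  move=> x [Dx dx].
  have {}H1 := H1 x (conj Dx (Rlt_le_trans _ _ _ dx (Rmin_l _ _))).
  have {}H2 := H2 x (conj Dx (Rlt_le_trans _ _ _ dx (Rmin_r _ _))).
  rewrite /= /Rdist in H1 H2 *.
  apply: Rabs_def1.
    by have := mlip x s; lra.
  have := mlip s x; rewrite (Rabs_minus_sym (fst (g s))) (Rabs_minus_sym (snd (g s))); lra.
have [s0 [s0P hs0]] := continuity_ab_min _ _ _ le01 (fun c _ => cm c).
exists (f s0 (m s0) / 2); have := fpos _ _ hs0 (mP s0).2 => pos; split; first lra.
move=> s t hs ht; have h1 := s0P _ hs; have h2 := (mP s).1 _ ht.
have h3 : f s t = Rabs (fst (g s) - fst (h t)) + Rabs (snd (g s) - snd (h t)) by [].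
case: (Rle_dec (f s0 (m s0) / 2) (Rabs (fst (g s) - fst (h t)))) => n1; first by left.
by right; lra.
Qed.

(** * Sampling paths on a grid *)

Definition grid (N k : nat) : R := INR k / INR N.

Lemma grid_bounds N k : (0 < N)%N -> (k <= N)%N -> 0 <= grid N k <= 1.
Proof.
move=> /ltP/lt_INR /= N0 /leP/le_INR kN; rewrite /grid.
have := pos_INR k => k0; split.
  by apply: Rmult_le_pos => //; apply: Rlt_le; apply: Rinv_0_lt_compat.
by apply: (Rmult_le_reg_r (INR N)) => //; field_simplify; lra.
Qed.

Lemma grid0 N : grid N 0 = 0.
Proof. by rewrite /grid /Rdiv Rmult_0_l. Qed.

Lemma gridN N : (0 < N)%N -> grid N N = 1.
Proof. by move=> /ltP/lt_INR /= N0; rewrite /grid; field; lra. Qed.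

Lemma fine_sampling (g : R -> point) (e : R) : planar_path g -> 0 < e ->
  exists N0, forall N, (N0 <= N)%N -> forall k, (k < N)%N ->
    Rabs (fst (g (grid N k)) - fst (g (grid N k.+1))) < e /\
    Rabs (snd (g (grid N k)) - snd (g (grid N k.+1))) < e.
Proof.
move=> [c1 c2] e0.
have [d1 H1] := @Heine_cor2 _ 0 1 (fun x _ => c1 x) (mkposreal e e0).
have [d2 H2] := @Heine_cor2 _ 0 1 (fun x _ => c2 x) (mkposreal e e0).
have d0 : 0 < Rmin d1 d2 by apply: Rmin_pos; apply: cond_pos.
have [N0 [hN0 N0pos]] := archimed_cor1 _ d0.
exists N0 => N /leP/le_INR N0N k kN.
have N0' := lt_INR _ _ N0pos; rewrite /= in N0'.
have Npos : (0 < N)%N by apply: leq_ltn_trans kN.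
have b1 := grid_bounds Npos (ltnW kN); have b2 := grid_bounds Npos kN.
have st : Rabs (grid N k - grid N k.+1) < Rmin d1 d2.
  rewrite /grid S_INR.
  replace (INR k / INR N - (INR k + 1) / INR N) with (- / INR N) by (field; lra).
  rewrite Rabs_Ropp Rabs_pos_eq; last by apply: Rlt_le; apply: Rinv_0_lt_compat; lra.
  by apply: Rle_lt_trans hN0; apply: Rinv_le_contravar; lra.
by split; [apply: H1 => //; apply: Rlt_le_trans st (Rmin_l _ _)
          |apply: H2 => //; apply: Rlt_le_trans st (Rmin_r _ _)].
Qed.

(* Points of the horizontal axis are split so that [upper (- u) = ~~ upper u]
   for [u] nonzero; [ray_cross u v] then counts mod 2 the crossings of a short
   step from [u] to [v] with the positive horizontal axis. *)
Definition upper (u : point) : bool :=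
  if Rlt_dec 0 (snd u) then true else
  if Rlt_dec (snd u) 0 then false else
  if Rlt_dec 0 (fst u) then true else false.

Definition rightward (u : point) : bool := if Rlt_dec 0 (fst u) then true else false.

Definition ray_cross (u v : point) : bool :=
  andb (xorb (upper u) (upper v)) (rightward u).

Definition big (d : R) (u : point) := d <= Rabs (fst u) \/ d <= Rabs (snd u).

Definition near (d : R) (u v : point) :=
  Rabs (fst u - fst v) < d /\ Rabs (snd u - snd v) < d.

Definition psub (u v : point) : point := (fst u - fst v, snd u - snd v).

Lemma upper_neg u v : psub u v <> (0, 0) -> upper (psub v u) = negb (upper (psub u v)).
Proof.
move=> ne; rewrite /upper /psub /=.
have ne' : ~ (fst u - fst v = 0 /\ snd u - snd v = 0).
  by move=> [a b]; case: ne; rewrite /psub a b.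
by do !(case: Rlt_dec => ? //=); lra.
Qed.

(** The heights of [u] and [v] have 0 between them and are within [d] of the height of [w]; so [w]
    is low and can be big only horizontally. *)
Lemma rightward_same d u v w : 0 < d -> big d w -> near d u v -> near d w u ->
  near d w v -> upper u <> upper v -> d <= Rabs (fst w) /\ Rabs (snd w) < d.
Proof.
rewrite /big /near => d0 bw [uv1 uv2] [wu1 wu2] [wv1 wv2] uvne.
have uv : (snd u <= 0 <= snd v) \/ (snd v <= 0 <= snd u).
  by move: uvne; rewrite /upper; do !(case: Rlt_dec => ? //=); lra.
have H : Rabs (snd w) < d.
  move/Rabs_def2: wu2; move/Rabs_def2: wv2 => [? ?] [? ?]; apply: Rabs_def1; lra.
by split=> //; lra.
Qed.

Lemma rightward_near d u v : d <= Rabs (fst u) -> d <= Rabs (fst v) -> near d u v ->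
  rightward u = rightward v.
Proof.
rewrite /rightward => bu bv [/Rabs_def2[n1 n2] _].
move: bu bv; rewrite /Rabs; do 2!case: Rcase_abs => ?; do 2!case: Rlt_dec => ? //=; lra.
Qed.

Lemma near_sym d u v : near d u v -> near d v u.
Proof. by rewrite /near => [[a b]]; rewrite Rabs_minus_sym (Rabs_minus_sym (snd v)). Qed.

Lemma near_refl d u : 0 < d -> near d u u.
Proof. by move=> d0; rewrite /near !Rminus_diag Rabs_R0. Qed.

(** The corners [a], [b], [e], [c] bound a cell that does not wind around the origin. Either all lie
    on one side of the axis and nothing is crossed, or [rightward] agrees at the starting points
    [a], [b], [c] and the changes of [upper] around the cell cancel. *)
Lemma ray_cross_cell d a b c e : 0 < d -> big d a -> big d b -> big d c -> big d e ->
  near d a b -> near d a c -> near d a e -> near d b c -> near d b e -> near d c e ->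
  xorb (ray_cross a b) (ray_cross c e) = xorb (ray_cross a c) (ray_cross b e).
Proof.
move=> d0 ba bb bc be ab ac ae bc' be' ce.
have main : (upper a = upper b /\ upper a = upper c /\ upper a = upper e) \/
   (rightward a = rightward b /\ rightward a = rightward c).
  have key u v : near d u v -> (forall w, w = a \/ w = b \/ w = c -> near d w u /\ near d w v) ->
      upper u <> upper v -> rightward a = rightward b /\ rightward a = rightward c.
    move=> uv H ne.
    have [na1 na2] := H a (or_introl erefl).
    have [nb1 nb2] := H b (or_intror (or_introl erefl)).
    have [nc1 nc2] := H c (or_intror (or_intror erefl)).
    have [xa _] := rightward_same d0 ba uv na1 na2 ne.
    have [xb _] := rightward_same d0 bb uv nb1 nb2 ne.
    have [xc _] := rightward_same d0 bc uv nc1 nc2 ne.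
    by split; [apply: rightward_near xa xb ab|apply: rightward_near xa xc ac].
  case: (bool_dec (upper a) (upper b)) => [eb|ne]; last first.
    right; apply: (key _ _ ab _ ne) => w [->|[->|->]]; split; solve [assumption | exact: near_refl | apply: near_sym; assumption].
  case: (bool_dec (upper a) (upper c)) => [ec|ne]; last first.
    right; apply: (key _ _ ac _ ne) => w [->|[->|->]]; split; solve [assumption | exact: near_refl | apply: near_sym; assumption].
  case: (bool_dec (upper a) (upper e)) => [ee|ne]; last first.
    right; apply: (key _ _ ae _ ne) => w [->|[->|->]]; split; solve [assumption | exact: near_refl | apply: near_sym; assumption].
  by left.
rewrite /ray_cross; case: main => [[<- [<- <-]]|[<- <-]]; first by case: (upper a).
by case: (upper a); case: (upper b); case: (upper c); case: (upper e); case: (rightward a).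
Qed.

(** Point reflection exchanges the two halves of the axis, and a short step that changes [upper]
    crosses exactly one of them. *)
Lemma ray_cross_neg d u v u' v' : 0 < d ->
  big d (psub u v) -> big d (psub u' v') -> near d (psub u v) (psub u' v') ->
  ray_cross (psub v u) (psub v' u') =
  xorb (ray_cross (psub u v) (psub u' v')) (xorb (upper (psub u v)) (upper (psub u' v'))).
Proof.
move=> d0 b1 b2 n.
have nz a b : big d (psub a b) -> psub a b <> (0, 0).
  by move=> [|] + E; rewrite E /= Rabs_R0; lra.
rewrite /ray_cross (upper_neg (nz _ _ b1)) (upper_neg (nz _ _ b2)).
case: (bool_dec (upper (psub u v)) (upper (psub u' v'))) => [->|ne].
  by case: (upper _).
have [xa _] := rightward_same d0 b1 n (near_refl _ d0) n ne.
have -> : rightward (psub v u) = negb (rightward (psub u v)).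
  move: xa; rewrite /rightward /psub /= /Rabs; case: Rcase_abs => ? ?; do 2!case: Rlt_dec => ? //=; lra.
by move: ne; case: (upper _); case: (upper _); case: (rightward _).
Qed.

(** * Sums mod 2 over a grid *)

Fixpoint xsum (f : nat -> bool) (n : nat) : bool :=
  if n is n'.+1 then xorb (xsum f n') (f n') else false.

Lemma xsum_telescope (f : nat -> bool) n :
  xsum (fun k => xorb (f k) (f k.+1)) n = xorb (f 0%N) (f n).
Proof. by elim: n => [|n /= ->]; rewrite ?xorb_nilpotent //; case: (f 0%N); case: (f n); case: (f n.+1). Qed.

Lemma xsumD (f g : nat -> bool) n :
  xsum (fun k => xorb (f k) (g k)) n = xorb (xsum f n) (xsum g n).
Proof. by elim: n => [|n /= ->] //; case: (xsum f n); case: (xsum g n); case: (f n); case: (g n). Qed.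

Lemma eq_xsum (f g : nat -> bool) n :
  (forall k, (k < n)%N -> f k = g k) -> xsum f n = xsum g n.
Proof.
elim: n => // n IH H /=; rewrite IH ?H // => k kn; apply: H; exact: ltnW.
Qed.

(** Adding [ray_cross_cell] over all cells, each inner side occurs twice and only the boundary
    remains. *)
Lemma ray_cross_square d N (U : nat -> nat -> point) : 0 < d ->
  (forall s t, (s <= N)%N -> (t <= N)%N -> big d (U s t)) ->
  (forall s t s' t', (s < N)%N -> (t < N)%N -> s' = s \/ s' = s.+1 -> t' = t \/ t' = t.+1 ->
     forall s'' t'', s'' = s \/ s'' = s.+1 -> t'' = t \/ t'' = t.+1 ->
     near d (U s' t') (U s'' t'')) ->
  xorb (xsum (fun s => ray_cross (U s 0%N) (U s.+1 0%N)) N)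
       (xsum (fun s => ray_cross (U s N) (U s.+1 N)) N) =
  xorb (xsum (fun t => ray_cross (U 0%N t) (U 0%N t.+1)) N)
       (xsum (fun t => ray_cross (U N t) (U N t.+1)) N).
Proof.
move=> d0 bU nU.
pose B t := xsum (fun s => ray_cross (U s t) (U s.+1 t)) N.
pose L s t := ray_cross (U s t) (U s t.+1).
have row t : (t < N)%N -> xorb (B t) (B t.+1) = xorb (L 0%N t) (L N t).
  move=> tN; rewrite -(xsum_telescope (fun s => L s t)) -xsumD; apply: eq_xsum => s sN.
  by apply: (@ray_cross_cell d) => //; (apply: bU || apply: (nU s t)); auto using ltnW.
rewrite -[LHS](xsum_telescope B) -xsumD; exact: eq_xsum.
Qed.

(** The parity of the crossings of the sampled path with the horizontal ray going right from [q]. *)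
Definition turns (g : R -> point) (N : nat) (q : point) : bool :=
  xsum (fun s => ray_cross (psub (g (grid N s)) q) (psub (g (grid N s.+1)) q)) N.

Definition fine (d : R) (N : nat) (g : R -> point) : Prop :=
  forall k, (k < N)%N -> near d (g (grid N k)) (g (grid N k.+1)).

Definition apart (d : R) (g h : R -> point) : Prop :=
  forall s t, 0 <= s <= 1 -> 0 <= t <= 1 -> big d (psub (g s) (h t)).

Lemma big_sym d u v : big d (psub u v) -> big d (psub v u).
Proof. by rewrite /big /= Rabs_minus_sym (Rabs_minus_sym (snd u)). Qed.

Lemma apart_sym d g h : apart d g h -> apart d h g.
Proof. by move=> H s t hs ht; apply: big_sym; exact: H. Qed.

(** [ray_cross_square] is applied to the differences of points of [g] and [h]. Two sides of the
    square give the turns of [g] about the ends of [h]; on the other two the differences are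
    reversed by [ray_cross_neg], which produces the terms [upper]. *)
Lemma turns_edge_to_edge d N (g h : R -> point) : 0 < d -> (0 < N)%N ->
  apart d g h -> fine (d / 2) N g -> fine (d / 2) N h ->
  xorb (xorb (turns g N (h 0)) (turns g N (h 1)))
       (xorb (turns h N (g 0)) (turns h N (g 1))) =
  xorb (xorb (upper (psub (h 0) (g 0))) (upper (psub (h 1) (g 0))))
       (xorb (upper (psub (h 0) (g 1))) (upper (psub (h 1) (g 1)))).
Proof.
move=> d0 N0 gh fg fh.
have ghN s t : (s <= N)%N -> (t <= N)%N -> big d (psub (g (grid N s)) (h (grid N t))).
  by move=> hs ht; apply: gh; apply: grid_bounds.
have step k (kN : (k < N)%N) (f : R -> point) : fine (d / 2) N f ->
    forall a b, a = k \/ a = k.+1 -> b = k \/ b = k.+1 -> near (d / 2) (f (grid N a)) (f (grid N b)).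
  move=> ff a b [->|->] [->|->]; solve [apply: near_refl; lra | exact: ff | apply: near_sym; exact: ff].
pose U s t := psub (g (grid N s)) (h (grid N t)).
(* Inside a cell both parameters may move, and two displacements below [d / 2] make one below
   [d]. *)
have nearU s t s' t' : (s < N)%N -> (t < N)%N -> s' = s \/ s' = s.+1 -> t' = t \/ t' = t.+1 ->
    forall s'' t'', s'' = s \/ s'' = s.+1 -> t'' = t \/ t'' = t.+1 -> near d (U s' t') (U s'' t'').
  move=> hs ht s1 t1 s'' t'' s2 t2.
  have [a1 a2] := step _ hs _ fg _ _ s1 s2; have [b1 b2] := step _ ht _ fh _ _ t1 t2.
  by move: a1 a2 b1 b2 => /Rabs_def2[? ?] /Rabs_def2[? ?] /Rabs_def2[? ?] /Rabs_def2[? ?];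
    split; apply: Rabs_def1; rewrite /=; lra.
have := ray_cross_square d0 ghN nearU; rewrite /U !grid0 !(gridN N0) => E.
have side q : q = g 0 \/ q = g 1 ->
  xsum (fun t => ray_cross (psub q (h (grid N t))) (psub q (h (grid N t.+1)))) N =
  xorb (turns h N q) (xorb (upper (psub (h 0) q)) (upper (psub (h 1) q))).
  move=> hq.
  have bq t : (t <= N)%N -> big d (psub (h (grid N t)) q).
    by move=> tN; case: hq => ->; apply: apart_sym gh _ _ _ _; try (exact: grid_bounds); lra.
  rewrite -(grid0 N) -(gridN N0) -(xsum_telescope (fun t => upper (psub (h (grid N t)) q))) -xsumD.
  apply: eq_xsum => t tN; apply: (ray_cross_neg d0).
  - exact/bq/ltnW.
  - exact: bq.
  - have [/Rabs_def2[? ?] /Rabs_def2[? ?]] := fh _ tN.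
    by split; apply: Rabs_def1; rewrite /=; lra.
move: E; rewrite -/(turns g N (h 0)) -/(turns g N (h 1)) => ->.
rewrite (side _ (or_introl erefl)) (side _ (or_intror erefl)); ring.
Qed.

Lemma finite_common_bound (I : finType) (P : I -> R -> Prop) :
  (forall i d d', 0 < d' <= d -> P i d -> P i d') ->
  (forall i, exists d, 0 < d /\ P i d) -> exists d, 0 < d /\ forall i, P i d.
Proof.
move=> Pdown Pex.
have [d [d0 dP]] : exists d, 0 < d /\ forall i, i \in enum I -> P i d.
  elim: (enum I) => [|i s [d [d0 IH]]]; first by exists 1; split; [lra|].
  have [e [e0 Pe]] := Pex i; exists (Rmin d e); split; first exact: Rmin_pos.
  have [[m0 md] me] := (Rmin_pos _ _ d0 e0, Rmin_l d e, Rmin_r d e).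
  move=> j; rewrite inE => /orP[/eqP->|/IH]; [apply: Pdown Pe|apply: Pdown]; lra.
by exists d; split=> // i; apply: dP; rewrite mem_enum.
Qed.

Lemma finite_common_index (I : finType) (P : I -> nat -> Prop) :
  (forall i, exists n, forall m, (n <= m)%N -> P i m) ->
  exists n, (0 < n)%N /\ forall i, P i n.
Proof.
move=> Pex.
have [n nP] : exists n, forall m, (n <= m)%N -> forall i, i \in enum I -> P i m.
  elim: (enum I) => [|i s [n IH]]; first by exists 0%N.
  have [k Pk] := Pex i; exists (maxn n k) => m; rewrite geq_max => /andP[nm km] j.
  by rewrite inE => /orP[/eqP->|/(IH _ nm)//]; exact: Pk.
exists n.+1; split=> // i; apply: nP => //; exact: mem_enum.
Qed.

(* Each pair of disjoint edges gives one relation mod 2 (turns_edge_to_edge);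
   adding up all 15 of them, every [turns] term occurs twice while the
   remaining terms [upper] add up to 1. *)
Theorem K5_meets (p : 'I_5 -> point) (A : 'I_5 -> 'I_5 -> point -> Prop) :
  (forall i j : 'I_5, (i < j)%N -> joined (A i j) (p i) (p j)) ->
  exists i j k l : 'I_5, [/\ (i < j)%N, (k < l)%N, i != k, i != l & j != k] /\ j != l /\
    exists q, A i j q /\ A k l q.
Proof.
move=> pA; apply: NNPP => nmeet.
(* Pairs that are not increasing receive a constant function, so that the choice is total. *)
have gex (e : 'I_5 * 'I_5) : exists g, (e.1 < e.2)%N -> planar_path g /\ g 0 = p e.1 /\ g 1 = p e.2 /\
    forall t, 0 <= t <= 1 -> A e.1 e.2 (g t).
  case: (ltnP e.1 e.2) => [lt|_]; last by exists (fun=> p e.1).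
  by have [g H] := pA _ _ lt; exists g.
pose g e := proj1_sig (constructive_indefinite_description _ (gex e)).
have gP (e : 'I_5 * 'I_5) : (e.1 < e.2)%N -> planar_path (g e) /\ g e 0 = p e.1 /\ g e 1 = p e.2 /\
    forall t, 0 <= t <= 1 -> A e.1 e.2 (g e t).
  by rewrite /g; case: constructive_indefinite_description.
pose indep (ef : ('I_5 * 'I_5) * ('I_5 * 'I_5)) :=
  [&& ef.1.1 < ef.1.2, ef.2.1 < ef.2.2, ef.1.1 != ef.2.1, ef.1.1 != ef.2.2, ef.1.2 != ef.2.1 & ef.1.2 != ef.2.2]%N.
have [d [d0 dP]] : exists d, 0 < d /\ forall ef, indep ef -> apart d (g ef.1) (g ef.2).
  apply: (@finite_common_bound _ (fun ef d => indep ef -> apart d (g ef.1) (g ef.2))) => [ef d d' dd' H ief s t hs ht|[e f]].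
    by case: (H ief s t hs ht) => ?; [left|right]; lra.
  case: (boolP (indep (e, f))) => [|_]; last by exists 1; split; [lra|].
  rewrite /indep /= => /and5P[l1 l2 n1 n2 /andP[n3 n4]].
  have [cg [_ [_ gA]]] := gP e l1; have [ch [_ [_ hA]]] := gP f l2.
  have [|d [d0 H]] := disjoint_paths_apart cg ch; last by exists d; split=> // _ s t.
  move=> s t hs ht E; case: nmeet; exists e.1, e.2, f.1, f.2; split; first by split.
  by split=> //; exists (g e s); split; [exact: gA|rewrite E; exact: hA].
have [N [N0 NP]] : exists N, (0 < N)%N /\ forall e : 'I_5 * 'I_5, (e.1 < e.2)%N -> fine (d / 2) N (g e).
  apply: (@finite_common_index _ (fun (e : 'I_5 * 'I_5) N => (e.1 < e.2)%N -> fine (d / 2) N (g e))) => e.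
  case: (ltnP e.1 e.2) => [lt|_]; last by exists 0%N.
  have [cg _] := gP e lt.
  have [|M MP] := @fine_sampling (g e) (d / 2) cg; first lra.
  by exists M => N MN _ k kN; exact: MP.
pose D i j k := turns (g (inord i, inord j)) N (p (inord k)).
pose H i j := upper (psub (p (inord j)) (p (inord i))).
have rel (i j k l : nat) : [&& i < 5, j < 5, k < 5 & l < 5]%N ->
  [&& i < j, k < l, i != k, i != l, j != k & j != l]%N ->
  xorb (xorb (D i j k) (D i j l)) (xorb (D k l i) (D k l j)) =
  xorb (xorb (H i k) (H i l)) (xorb (H j k) (H j l)).
  move=> /and4P[i5 j5 k5 l5] ind.
  have := @turns_edge_to_edge d N (g (inord i, inord j)) (g (inord k, inord l)) d0 N0.
  have [|_ [-> [-> _]]] := gP (inord i, inord j); first by rewrite /= !inordK //; case/and5P: ind.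
  have [|_ [-> [-> _]]] := gP (inord k, inord l); first by rewrite /= !inordK //; case/and5P: ind.
  apply.
  - by apply: (dP ((_, _), (_, _))); rewrite /indep /= -!val_eqE /= !inordK.
  - by apply: NP; rewrite /= !inordK //; case/and5P: ind.
  - by apply: NP; rewrite /= !inordK //; case/and5P: ind.
(* If two of the points coincided, two disjoint edges, one from each, would meet there. *)
have pinj i j : i != j -> p i <> p j.
  move=> ij E; have /card_gt1P[k [l []]] : (1 < #|~: [set i; j]|)%N.
    by rewrite cardsCs setCK cards2 card_ord; case: (_ != _).
  rewrite !inE !negb_or => /andP[ki kj] /andP[li lj] kl.
  have ends u v : u != v -> exists a b : 'I_5, [/\ (a < b)%N, (a = u /\ b = v) \/ (a = v /\ b = u) & A a b (p u)].
    move=> uv; case: (ltngtP u v) => [lt|lt|/val_inj e]; last by rewrite e eqxx in uv.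
      have [_ [<- [_ gA]]] := gP (u, v) lt.
      by exists u, v; split=> //; [left|apply: gA; lra].
    have [_ [_ [<- gA]]] := gP (v, u) lt.
    by exists v, u; split=> //; [right|apply: gA; lra].
  have [a [b [ab eab Aab]]] : exists a b : 'I_5, [/\ (a < b)%N, (a = i /\ b = k) \/ (a = k /\ b = i) & A a b (p i)].
    by apply: ends; rewrite eq_sym.
  have [c [e [ce ece Ace]]] : exists a b : 'I_5, [/\ (a < b)%N, (a = j /\ b = l) \/ (a = l /\ b = j) & A a b (p j)].
    by apply: ends; rewrite eq_sym.
  apply: nmeet; exists a, b, c, e; split.
    by case: eab => [[? ?]|[? ?]]; case: ece => [[? ?]|[? ?]]; subst; split=> //; rewrite eq_sym.
  split; first by case: eab => [[_ ->]|[_ ->]]; case: ece => [[_ ->]|[_ ->]] //; rewrite eq_sym.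
  by exists (p i); split=> //; rewrite E.
have anti (i j : nat) : (i < j < 5)%N -> H j i = xorb true (H i j).
  move=> /andP[ij j5]; apply: upper_neg => -[e1 e2].
  apply: (pinj (inord i) (inord j)); first by rewrite -val_eqE /= !inordK ?ltn_eqF // (ltn_trans ij).
  by rewrite (surjective_pairing (p (inord i))) (surjective_pairing (p (inord j))); congr pair; lra.
pose pairs := [:: (0,1,2,3); (0,1,2,4); (0,1,3,4); (0,2,1,3); (0,2,1,4); (0,2,3,4);
  (0,3,1,2); (0,3,1,4); (0,3,2,4); (0,4,1,2); (0,4,1,3); (0,4,2,3);
  (1,2,3,4); (1,3,2,4); (1,4,2,3)]%N.
pose xall (F : nat -> nat -> nat -> nat -> bool) :=
  foldr (fun q => let: (i, j, k, l) := q in xorb (F i j k l)) false pairs.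
have : xall (fun i j k l => xorb (xorb (D i j k) (D i j l)) (xorb (D k l i) (D k l j))) =
       xall (fun i j k l => xorb (xorb (H i k) (H i l)) (xorb (H j k) (H j l))).
  by rewrite /xall /=; do 15!(rewrite rel //).
have -> : xall (fun i j k l => xorb (xorb (D i j k) (D i j l)) (xorb (D k l i) (D k l j))) = false.
  by rewrite /xall /=; ring.
(* Each pair of vertices is separated in six of the 15 relations, so all terms [H] cancel once
   [anti] has put their indices in increasing order. The constant 1 remains because 15 terms are
   reversed. *)
rewrite /xall /= => E; suff : true = false by [].
rewrite [RHS]E (anti 1 2)%N // (anti 1 3)%N // (anti 1 4)%N // (anti 2 3)%N // (anti 2 4)%N // (anti 3 4)%N //.
ring.
Qed.

End PlanePaths.

(** * The edge bound *)

Section WeaklyPlanar.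
Variable T : finType.
Implicit Types (S : {set T}) (r : rel T).

Definition degree_in S r x : nat := \sum_(y in S) r x y.

(** Twice the number of edges when [r] is symmetric. *)
Definition adjacent_pairs S r : nat := \sum_(x in S) degree_in S r x.

(** Edges sharing an end may meet anywhere, which is what lets the property survive contraction. *)
Definition weakly_planar S r : Prop :=
  exists (p : T -> point) (A : T -> T -> point -> Prop),
  (forall x y, x \in S -> y \in S -> r x y -> joined (A x y) (p x) (p y)) /\
  (forall x y z w, x \in S -> y \in S -> z \in S -> w \in S -> r x y -> r z w ->
     [&& x != z, x != w, y != z & y != w] -> forall q, A x y q -> A z w q -> False).

Lemma weakly_planar_sub S S' r r' : S' \subset S ->
  (forall x y, r' x y -> r x y) -> weakly_planar S r -> weakly_planar S' r'.
Proof.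
move=> /subsetP sS sr [p [A [pA indA]]]; exists p, A; split.
  by move=> x y /sS xS /sS yS /sr; exact: pA.
by move=> x y z w /sS xS /sS yS /sS zS /sS wS /sr rxy /sr; exact: indA.
Qed.

Lemma weakly_planar_K5_free S r (s : seq T) : weakly_planar S r ->
  size s = 5 -> uniq s -> {subset s <= S} -> pairwise r s -> False.
Proof.
move=> [p [A [pA indA]]]; case: s => // v s' ss us sS prs; set s := v :: s' in ss us sS prs.
have inS (i : 'I_5) : nth v s i \in S by apply: sS; rewrite mem_nth // ss.
have rs (i j : 'I_5) : (i < j)%N -> r (nth v s i) (nth v s j).
  by move=> ij; apply: (pairwiseP v prs) => //; rewrite inE ss.
have [i j ij|i [j [k [l [[ij kl ik il jk] [jl [q [q1 q2]]]]]]]] :=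
    @K5_meets (fun i => p (nth v s i)) (fun i j => A (nth v s i) (nth v s j)).
  by apply: pA => //; exact: rs.
apply: (indA _ _ _ _ (inS i) (inS j) (inS k) (inS l) (rs _ _ ij) (rs _ _ kl) _ q q1 q2).
by rewrite !nth_uniq ?ss //; apply/and4P.
Qed.

(** [v] is merged into [u]; it stays in the type [T] and is dropped from the vertex set instead. The
    conditions [y != u] and [x != u] prevent a loop at [u]. *)
Definition contract r (u v : T) : rel T := fun x y =>
  [|| r x y, [&& x == u, r v y & y != u] | [&& y == u, r v x & x != u]].

Lemma contract_sym r u v : symmetric r -> symmetric (contract r u v).
Proof.
by move=> rs x y; rewrite /contract rs; congr (_ || _); rewrite orbC.
Qed.

Lemma contract_irr r u v : irreflexive r -> irreflexive (contract r u v).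
Proof.
by move=> ri x; rewrite /contract ri /=; case: eqP => //= _; rewrite !andbF.
Qed.

(** A new edge from [u] to [y] runs along [uv] and [vy]. An old edge disjoint from it avoids [u] and
    [y], and also the deleted [v], so it is disjoint from both [uv] and [vy]. *)
Lemma weakly_planar_contract S r u v : symmetric r -> u \in S -> v \in S -> r u v ->
  weakly_planar S r -> weakly_planar (S :\ v) (contract r u v).
Proof.
move=> rs uS vS ruv [p [A [pA indA]]].
exists p, (fun x y q => if r x y then A x y q else
  if x == u then A u v q \/ A v y q else A x v q \/ A v u q).
split.
  move=> x y; rewrite !inE => /andP[xv xS] /andP[yv yS] c.
  case rxy: (r x y); first exact: pA.
  case: (eqVneq x u) => [xu|/eqP xu].
    subst x.
    have rvy : r v y by move: c; rewrite /contract rxy eqxx /= => /orP[/andP[]//|]; rewrite andbF andbF.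
    apply: (@joined_trans _ _ (p v)).
      by apply: joined_sub (pA _ _ uS vS ruv) => q; left.
    by apply: joined_sub (pA _ _ vS yS rvy) => q; right.
  have [yu rvx] : y = u /\ r v x.
    by move: c; rewrite /contract rxy (introF eqP xu) /= => /and3P[/eqP].
  subst y; apply: (@joined_trans _ _ (p v)).
    by apply: joined_sub (pA _ _ xS vS _) => [q|]; [left|rewrite rs].
  by apply: joined_sub (pA _ _ vS uS _) => [q|]; [right|rewrite rs].
move=> x y z w; rewrite !inE => /andP[xv xS] /andP[yv yS] /andP[zv zS] /andP[wv wS].
have key x' y' z' w' : x' \in S -> y' \in S -> z' \in S -> w' \in S ->
    z' != v -> w' != v -> x' != v -> y' != v ->
    contract r u v x' y' -> ~~ r x' y' -> r z' w' ->
    [&& x' != z', x' != w', y' != z' & y' != w'] -> forall q,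
    (if x' == u then A u v q \/ A v y' q else A x' v q \/ A v u q) -> A z' w' q -> False.
  move=> x'S y'S z'S w'S z'v w'v x'v y'v c /negPf nr rzw /and4P[n1 n2 n3 n4] q.
  case: eqP => [xu|xu].
    subst x'.
    have rvy : r v y' by move: c; rewrite /contract nr eqxx /= => /orP[/andP[]//|]; rewrite !andbF.
    by case=> q1 q2; [apply: (indA u v z' w') q1 q2|apply: (indA v y' z' w') q1 q2];
      rewrite ?n1 ?n2 ?n3 ?n4 ?(eq_sym v) ?z'v ?w'v.
  have [yu rvx] : y' = u /\ r v x'.
    by move: c; rewrite /contract nr (introF eqP xu) /= => /and3P[/eqP].
  have rvu : r v u by rewrite rs.
  have rxv : r x' v by rewrite rs.
  subst y'.
  by case=> q1 q2; [apply: (indA x' v z' w') q1 q2|apply: (indA v u z' w') q1 q2];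
      rewrite ?n1 ?n2 ?n3 ?n4 ?(eq_sym v) ?z'v ?w'v.
move=> c1 c2 n q; case r1: (r x y); case r2: (r z w).
- exact: indA n q.
- move=> q1 q2; apply: (key z w x y _ _ _ _ _ _ _ _ c2 _ r1 _ q q2 q1) => //; first exact: negbT.
  by case/and4P: n => n1 n2 n3 n4; rewrite eq_sym n1 eq_sym n3 eq_sym n2 eq_sym n4.
- by move=> q1 q2; apply: (key x y z w _ _ _ _ _ _ _ _ c1 _ r2 _ q q1 q2) => //; exact: negbT.
(* Both edges are new, so both contain [u]. *)
have hu x' y' : contract r u v x' y' -> r x' y' = false -> x' = u \/ y' = u.
  by move=> + nr; rewrite /contract nr /= => /orP[/and3P[/eqP-> _ _]|/and3P[/eqP-> _ _]]; [left|right].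
case: (hu _ _ c1 r1) => ?; case: (hu _ _ c2 r2) => ?; subst; by rewrite eqxx ?andbF in n.
Qed.

(** * Counting edges under deletion and contraction *)

Lemma degree_inE S r x : degree_in S r x = #|[set y in S | r x y]|.
Proof.
rewrite /degree_in -sum1_card big_mkcond [RHS]big_mkcond /=.
by apply: eq_bigr => y _; rewrite inE; case: (y \in S); case: (r x y).
Qed.

Lemma adjacent_pairs_delete S r v : symmetric r -> irreflexive r -> v \in S ->
  adjacent_pairs S r = adjacent_pairs (S :\ v) r + 2 * degree_in S r v.
Proof.
move=> rs ri vS; rewrite /adjacent_pairs (big_setD1 v) //=.
have -> : \sum_(x in S :\ v) degree_in S r x =
  \sum_(x in S :\ v) (degree_in (S :\ v) r x + r v x).
  by apply: eq_bigr => x _; rewrite {1}/degree_in (big_setD1 v) //= addnC rs.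
have e : degree_in S r v = \sum_(x in S :\ v) r v x.
  by rewrite /degree_in (big_setD1 v) //= ri.
by rewrite big_split /= -e; lia.
Qed.

Lemma degree_in_lt S r x : irreflexive r -> x \in S -> degree_in S r x < #|S|.
Proof.
move=> ri xS; rewrite degree_inE (cardsD1 x S) xS ltnS; apply: subset_leq_card.
by apply/subsetP => y; rewrite !inE => /andP[-> ]; case: eqP => // ->; rewrite ri.
Qed.

Definition common_neighbours S r u v : {set T} := [set y in S | r u y && r v y].

(** The contraction loses the edge [uv] and one edge for each common neighbour, counted in both
    orders. *)
Lemma adjacent_pairs_contract S r u v : symmetric r -> irreflexive r ->
  u \in S -> v \in S -> r u v ->
  adjacent_pairs S r <=
  adjacent_pairs (S :\ v) (contract r u v) + 2 * (#|common_neighbours S r u v| + 1).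
Proof.
move=> rs ri uS vS ruv; rewrite (adjacent_pairs_delete rs ri vS).
have uv : u != v by apply: contraTneq ruv => ->; rewrite ri.
have uS' : u \in S :\ v by rewrite !inE uv.
(* The pairs gained: from [u] to a neighbour of [v] that was not adjacent to [u]. *)
pose n x y : bool := [&& x == u, r v y, ~~ r u y & y != u].
have le1 : \sum_(x in S :\ v) \sum_(y in S :\ v) (r x y + n x y + n y x) <=
  adjacent_pairs (S :\ v) (contract r u v).
  rewrite /adjacent_pairs; apply: leq_sum => x _; rewrite /degree_in; apply: leq_sum => y _.
  rewrite /n /contract; case: (eqVneq x u) => [->|xu]; case: (eqVneq y u) => [->|yu] /=;
    rewrite ?ri ?(rs _ u) ?andbF ?andbT ?orbF ?addn0 //=.
  - by case: (r u y); case: (r v y).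
  - by case: (r u x); case: (r v x).
have e1 : \sum_(x in S :\ v) \sum_(y in S :\ v) (r x y + n x y + n y x) =
   adjacent_pairs (S :\ v) r + 2 * \sum_(y in S :\ v) n u y.
  have e2 : \sum_(x in S :\ v) \sum_(y in S :\ v) n x y = \sum_(y in S :\ v) n u y.
    rewrite (big_setD1 u) //= [X in _ + X]big1 ?addn0 // => x; rewrite !inE => /andP[/negPf xu _].
    by apply: big1 => y _; rewrite /n xu.
  under eq_bigr => x _ do rewrite big_split big_split /=.
  have e3 : \sum_(x in S :\ v) \sum_(y in S :\ v) n y x = \sum_(y in S :\ v) n u y.
    by rewrite exchange_big.
  rewrite !big_split /= e2 e3.
  by rewrite /adjacent_pairs /degree_in; lia.
have : degree_in S r v <= \sum_(y in S :\ v) n u y + (#|common_neighbours S r u v| + 1).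
  have -> : degree_in S r v = \sum_(y in S :\ v) r v y.
    by rewrite /degree_in (big_setD1 v) //= ri.
  have -> : 1 = \sum_(y in S :\ v) (y == u).
    by rewrite (big_setD1 u) //= eqxx big1 ?addn0 // => y; rewrite !inE => /andP[/negPf ->].
  have -> : #|common_neighbours S r u v| = \sum_(y in S :\ v) (r u y && r v y).
    rewrite -sum1_card big_mkcond [RHS]big_mkcond /=; apply: eq_bigr => y _.
    rewrite !inE; case: (eqVneq y v) => [->|_]; first by rewrite ri !andbF.
    by case: (y \in S); case: (r u y && r v y).
  rewrite -!big_split /=; apply: leq_sum => y _; rewrite /n eqxx.
  by case: (r v y); case: (r u y); case: (y == u).
lia.
Qed.

Definition remove_edge r (a b : T) : rel T := fun x y =>
  r x y && ~~ (((x == a) && (y == b)) || ((x == b) && (y == a))).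

Lemma remove_edge_sym r a b : symmetric r -> symmetric (remove_edge r a b).
Proof.
move=> rs x y; rewrite /remove_edge rs orbC; congr (_ && ~~ (_ || _)); exact: andbC.
Qed.

Lemma remove_edge_irr r a b : irreflexive r -> irreflexive (remove_edge r a b).
Proof. by move=> ri x; rewrite /remove_edge ri. Qed.

Lemma adjacent_pairs_remove_edge S r a b :
  adjacent_pairs S r <= adjacent_pairs S (remove_edge r a b) + 2.
Proof.
have le2 : \sum_(x in S) \sum_(y in S) (((x == a) && (y == b)) + ((x == b) && (y == a))) <= 2.
  have aux (c d : T) : \sum_(x in S) \sum_(y in S) ((x == c) && (y == d)) <= 1.
    have le1 e : \sum_(x in S) (x == e) <= 1.
      have [eS|eS] := boolP (e \in S); first by rewrite (big_setD1 e) //= eqxx big1 // => y; rewrite !inE => /andP[/negPf ->].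
      by rewrite big1 // => y yS; case: eqP => // ye; rewrite -ye yS in eS.
    apply: leq_trans (le1 c); apply: leq_sum => x _; case: (x == c) => /=; first exact: le1.
    by rewrite big1.
  under eq_bigr => x _ do rewrite big_split /=.
  by rewrite big_split /= -[2]/(1 + 1); apply: leq_add.
apply: leq_trans (leq_add (leqnn _) le2); rewrite /adjacent_pairs -big_split /=.
apply: leq_sum => x _; rewrite /degree_in -big_split /=; apply: leq_sum => y _.
by rewrite /remove_edge; case: (r x y); case: (x == a); case: (y == b); case: (x == b); case: (y == a).
Qed.

Lemma adjacent_pairs_remove_edge_lt S r a b : a \in S -> b \in S -> r a b ->
  adjacent_pairs S (remove_edge r a b) < adjacent_pairs S r.
Proof.
move=> aS bS rab; rewrite /adjacent_pairs (big_setD1 a) //= [X in _ < X](big_setD1 a) //= -addSn.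
apply: leq_add; last first.
  by apply: leq_sum => x _; apply: leq_sum => y _; rewrite /remove_edge; case: (r x y) => //=; exact: leq_b1.
rewrite /degree_in (big_setD1 b) //= [X in _ < X](big_setD1 b) //= -addSn.
apply: leq_add; first by rewrite /remove_edge rab !eqxx.
by apply: leq_sum => y _; rewrite /remove_edge; case: (r a y) => //=; exact: leq_b1.
Qed.
End WeaklyPlanar.

Section EdgeBound.
Variable T : finType.
Implicit Types (S : {set T}) (r : rel T).

(** A K4 in the neighbourhood [N] of [v] forms a K5 with [v]. Otherwise [N] has 5 vertices, each
    missing at most one other, and contains two disjoint nonadjacent pairs [aa'] and [bb'];
    contracting [ab] then yields a K5. *)
Lemma weakly_planar_dense_neighbourhood S r v : symmetric r -> irreflexive r ->
  weakly_planar S r -> v \in S -> 4 <= degree_in S r v <= 5 ->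
  (forall w, w \in S -> r v w -> 3 <= #|common_neighbours S r v w|) -> False.
Proof.
move=> rs ri wp vS dv cn; set N := [set y in S | r v y].
have cN : #|N| = degree_in S r v by rewrite degree_inE.
have NP x : x \in N -> [/\ x \in S, r v x & x != v].
  rewrite inE => /andP[xS rvx]; split=> //; apply: contraTneq rvx => ->; by rewrite ri.
have cnN w : w \in N -> 3 <= #|[set y in N | r w y]|.
  move=> /NP[wS rvw _]; apply: leq_trans (cn w wS rvw) _; apply: subset_leq_card.
  by apply/subsetP => y; rewrite !inE => /and3P[-> -> ->].
have clique4 (a b c d : T) : [/\ a \in N, b \in N, c \in N & d \in N] ->
    uniq [:: a; b; c; d] -> pairwise r [:: a; b; c; d] -> False.
  move=> [aN bN cN' dN] us prs.
  apply: (@weakly_planar_K5_free _ S r [:: v; a; b; c; d] wp) => //.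
  - rewrite cons_uniq us andbT !inE !negb_or.
    by rewrite !(eq_sym v); case/NP: aN => _ _ ->; case/NP: bN => _ _ ->;
      case/NP: cN' => _ _ ->; case/NP: dN => _ _ ->.
  - by move=> x; rewrite !inE => /or4P[/eqP->|/eqP->|/eqP->|/orP[/eqP->|/eqP->]] //;
      [case/NP: aN|case/NP: bN|case/NP: cN'|case/NP: dN].
  - by rewrite pairwise_cons prs andbT /=; case/NP: aN => _ -> _; case/NP: bN => _ -> _;
      case/NP: cN' => _ -> _; case/NP: dN => _ -> _.
(* Having three neighbours in [N], [w] misses at most |N| - 4 others, hence not all of [X]. *)
have adj w (X : {set T}) : w \in N -> X \subset N -> w \notin X -> #|N| < 4 + #|X| ->
    exists2 x, x \in X & r w x.
  move=> wN /subsetP XN wX cX; apply/exists_inP; apply: contraT; rewrite negb_exists_in => /forall_inP nX.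
  have : #|[set y in N | r w y]| <= #|N :\: (w |: X)|.
    apply: subset_leq_card; apply/subsetP => y; rewrite in_set => /andP[yN rwy]; rewrite in_setD yN andbT in_setU1 negb_or.
    by apply/andP; split; [apply: contraTneq rwy => ->; rewrite ri|apply: contraL rwy; exact: nX].
  rewrite cardsD (setIidPr _); last by apply/subsetP => x; rewrite in_setU1 => /orP[/eqP->|/XN].
  by rewrite cardsU1 wX; have := cnN _ wN; lia.
case: (boolP [exists a in N, [exists b in N, (a != b) && ~~ r a b]]).
  case/exists_inP=> a aN /exists_inP[a' a'N /andP[aa' nraa']].
  have c5 : #|N| = 5.
    case: (ltnP #|N| 5) => [lt|]; last by lia.
    have [||||x] := adj a [set a']; rewrite ?sub1set ?in_set1 ?cards1 //.
    by move=> /eqP->; rewrite (negPf nraa').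
  have adj1 w x y : w \in N -> x \in N -> y \in N -> w != x -> w != y -> x != y -> ~~ r w x -> r w y.
    move=> wN xN yN wx wy xy nwx; have [||||z] := adj w [set x; y]; rewrite ?in_set2 ?negb_or ?wx ?wy ?cards2 ?xy ?c5 //.
      by apply/subsetP => z; rewrite in_set2 => /orP[/eqP->|/eqP->].
    by move=> /orP[/eqP->|/eqP->] //; rewrite (negPf nwx).
  pose M := N :\ a :\ a'.
  have cM : #|M| = 3.
    move: (cardsD1 a N) (cardsD1 a' (N :\ a)); rewrite aN c5 2!inE eq_sym aa' a'N -/M; lia.
  have MP x : x \in M -> [/\ x \in N, x != a & x != a'].
    by rewrite in_setD1 in_setD1 => /and3P[-> -> ->].
  have aM x : x \in M -> r a x.
    by move=> /MP[xN xa xa']; apply: (adj1 a a' x) => //; rewrite eq_sym.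
  have a'M x : x \in M -> r a' x.
    by move=> /MP[xN xa xa']; apply: (adj1 a' a x) => //; rewrite 1?eq_sym // rs.
  case: (boolP [exists b in M, [exists b' in M, (b != b') && ~~ r b b']]).
    case/exists_inP=> b bM /exists_inP[b' b'M /andP[bb' nrbb']].
    have [h hM] : exists h, h \in M :\ b :\ b'.
      apply/card_gt0P; move: (cardsD1 b M) (cardsD1 b' (M :\ b)); rewrite bM cM in_setD1 eq_sym bb' b'M; lia.
    move: hM; rewrite 2!in_setD1 => /and3P[hb' hb hM].
    case/MP: (bM) => bN ba ba'; case/MP: (b'M) => b'N b'a b'a'; case/MP: (hM) => hN ha ha'.
    have rbh : r b h by apply: (adj1 b b' h) => //; rewrite eq_sym.
    have rb'h : r b' h by apply: (adj1 b' b h) => //; rewrite 1?eq_sym // rs.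
    case/NP: (aN) => aS va av; case/NP: (a'N) => a'S va' a'v; case/NP: (hN) => hS vh hv.
    case/NP: (bN) => bS vb bv; case/NP: (b'N) => b'S vb' b'v.
    (* The contraction makes [a] adjacent to [a'] through [b], and the pair [bb'] disappears with
       [b]. *)
    have wp' := weakly_planar_contract rs aS bS (aM _ bM) wp.
    apply: (@weakly_planar_K5_free _ _ _ [:: v; h; a; a'; b'] wp') => //.
    - by rewrite /= !inE !negb_or !(eq_sym v) hv av a'v b'v ha ha' hb' aa' (eq_sym a) (eq_sym a') b'a b'a'.
    - move=> x; rewrite !inE => /or4P[/eqP->|/eqP->|/eqP->|/orP[/eqP->|/eqP->]];
      by rewrite ?vS ?aS ?hS ?a'S ?b'S ?(eq_sym v) ?bv ?hb ?(eq_sym a) ?ba ?(eq_sym a') ?ba' ?(eq_sym b') ?bb'.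
    - rewrite /= /contract vh va va' vb' (rs h) aM // (rs h a') a'M // (rs h b') rb'h (aM b') // (a'M b') //=.
      by rewrite eqxx (rs b) (a'M b) // (eq_sym a') aa' !orbT.
  rewrite negb_exists_in => /forall_inP nM.
  have Mr x y : x \in M -> y \in M -> x != y -> r x y.
    move=> xM yM xy; apply: contraT => nr; have := nM x xM; rewrite negb_exists_in => /forall_inP/(_ y yM).
    by rewrite xy nr.
  move: cM (enum_uniq M) (mem_enum M); rewrite cardE.
  case: (enum M) => [|x [|y [|z [|]]]] //= _ /and3P[]; rewrite !inE negb_or => /andP[xy xz] yz _ mM.
  have [xM yM zM] : [/\ x \in M, y \in M & z \in M] by rewrite -!mM !inE !eqxx !orbT.
  case/MP: (xM) => xN xa _; case/MP: (yM) => yN ya _; case/MP: (zM) => zN za _.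
  apply: (clique4 a x y z) => //.
    by rewrite /= !inE !negb_or !(eq_sym a) xa ya za xy xz yz.
  by rewrite /= !aM // !Mr.
rewrite negb_exists_in => /forall_inP nN.
have Nr x y : x \in N -> y \in N -> x != y -> r x y.
  move=> xN yN xy; apply: contraT => nr; have := nN x xN; rewrite negb_exists_in => /forall_inP/(_ y yN).
  by rewrite xy nr.
have : 4 <= #|N| by lia.
move: (enum_uniq N) (mem_enum N); rewrite cardE.
case: (enum N) => [|x [|y [|z [|w s]]]] // us mN _.
have [xN yN zN wN] : [/\ x \in N, y \in N, z \in N & w \in N].
  by rewrite -!mN !inE !eqxx !orbT.
have us' : uniq [:: x; y; z; w].
  by move: us; rewrite -[_ :: _]/([:: x; y; z; w] ++ s) cat_uniq => /and3P[].
apply: (clique4 x y z w) => //.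
by move: us'; rewrite /= !inE !negb_or !andbT => /and3P[/and3P[? ? ?] /andP[? ?] ?]; rewrite !Nr.
Qed.

(* Mader's argument for K5 minors: in a minimal counterexample deleting a
   vertex of degree at most 3, or contracting an edge whose ends have at most 2
   common neighbours, would give a smaller one. *)
Theorem weakly_planar_edge_bound S r : symmetric r -> irreflexive r ->
  weakly_planar S r -> 3 <= #|S| -> adjacent_pairs S r + 12 <= 6 * #|S|.
Proof.
(* Deleting a vertex and contracting an edge use the outer induction, removing an edge the inner
   one. *)
have [n] := ubnP #|S|; elim: n S r => // n IHn S r; rewrite ltnS => Sn.
have [m] := ubnP (adjacent_pairs S r); elim: m r => // m IHm r; rewrite ltnS => Sm rs ri wp S3.
rewrite leqNgt; apply/negP => gt.
have degS x : x \in S -> degree_in S r x < #|S| by move=> xS; exact: degree_in_lt.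
(* Three vertices have at most 6 adjacent pairs, which meets the bound; from four on, one vertex can
   be spared. *)
have S4 : 4 <= #|S|.
  rewrite ltn_neqAle S3 andbT; apply/eqP => e3.
  have : adjacent_pairs S r <= \sum_(x in S) 2.
    by apply: leq_sum => x /degS; rewrite -e3.
  by rewrite sum_nat_const -e3; lia.
have cD v : v \in S -> #|S| = #|S :\ v|.+1 by move=> vS; rewrite (cardsD1 v) vS.
have deg4 v : v \in S -> 4 <= degree_in S r v.
  move=> vS; rewrite leqNgt; apply/negP => lt.
  have := adjacent_pairs_delete rs ri vS; have cv := cD v vS.
  have := IHn (S :\ v) r _ rs ri (weakly_planar_sub (subsetDl _ _) (fun _ _ h => h) wp) _.
  by lia.
have cn3 v w : v \in S -> w \in S -> r v w -> 3 <= #|common_neighbours S r v w|.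
  move=> vS wS rvw; rewrite leqNgt; apply/negP => lt.
  have := adjacent_pairs_contract rs ri vS wS rvw; have cw := cD w wS.
  have := IHn (S :\ w) _ _ (@contract_sym _ _ v w rs) (@contract_irr _ _ v w ri)
    (weakly_planar_contract rs vS wS rvw wp) _.
  by lia.
(* If all degrees were at least 6, there would be at least 6|S| adjacent pairs, and removing one
   edge would leave a smaller counterexample. *)
have [v vS d5] : exists2 v, v \in S & degree_in S r v <= 5.
  apply/exists_inP; apply: contraT; rewrite negb_exists_in => /forall_inP d6.
  have [v vS] : exists v, v \in S by apply/card_gt0P; lia.
  have [w] : exists w, w \in [set y in S | r v y].
    by apply/card_gt0P; rewrite -degree_inE; have := deg4 v vS; lia.
  rewrite inE => /andP[wS rvw].
  have : \sum_(x in S) 6 <= adjacent_pairs S r.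
    by apply: leq_sum => x /d6; rewrite -ltnNge.
  rewrite sum_nat_const => big6.
  have := adjacent_pairs_remove_edge S r v w.
  have := adjacent_pairs_remove_edge_lt vS wS rvw.
  have := IHm (remove_edge r v w) _ (remove_edge_sym v w rs) (remove_edge_irr v w ri)
    (weakly_planar_sub (subxx _) _ wp) S3.
  move=> H lt le; have : adjacent_pairs S (remove_edge r v w) + 12 <= 6 * #|S|.
    by apply: H; [lia|move=> x y /andP[]].
  lia.
by apply: (@weakly_planar_dense_neighbourhood S r v) => // [|w]; [rewrite deg4|exact: cn3].
Qed.

End EdgeBound.

(** * Drawings with three crossings *)

Lemma same_edge_sym (T : finType) (a b c d : T) : same_edge a b c d -> same_edge c d a b.
Proof. by case=> [[-> ->]|[-> ->]]; [left|right]. Qed.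

Lemma same_edge_trans (T : finType) (a b c d x y : T) :
  same_edge a b c d -> same_edge c d x y -> same_edge a b x y.
Proof.
by case=> [[-> ->]|[-> ->]]; case=> [[-> ->]|[-> ->]]; (by left) || by right.
Qed.

(** * Removing and adding edges *)

Section RemoveEdges.
Variable T : finType.

Definition remove_edges (r : rel T) (es : seq (T * T)) : rel T :=
  foldr (fun ab r => remove_edge r ab.1 ab.2) r es.

Lemma remove_edges_sym r es : symmetric r -> symmetric (remove_edges r es).
Proof. by move=> rs; elim: es => //= ab es; exact: remove_edge_sym. Qed.

Lemma remove_edges_irr r es : irreflexive r -> irreflexive (remove_edges r es).
Proof. by move=> ri; elim: es => //= ab es; exact: remove_edge_irr. Qed.

Lemma remove_edgesP r es x y : remove_edges r es x y ->
  r x y /\ forall ab, ab \in es -> ~ same_edge x y ab.1 ab.2.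
Proof.
elim: es => [//|[a b] es IH] /= /andP[/IH[rxy nes] nab]; split=> // -[c d].
rewrite inE => /orP[/eqP[-> ->]|]; last exact: nes.
by move: nab => /negP nab s; apply: nab; case: s => [[-> ->]|[-> ->]]; rewrite !eqxx ?orbT.
Qed.

Lemma adjacent_pairs_remove_edges (S : {set T}) r es :
  adjacent_pairs S r <= adjacent_pairs S (remove_edges r es) + 2 * size es.
Proof.
elim: es => [|[a b] es IH] /=; first by rewrite addn0.
by have := adjacent_pairs_remove_edge S (remove_edges r es) a b; lia.
Qed.

Definition add_edge (r : rel T) (a b : T) : rel T := fun x y =>
  r x y || (((x == a) && (y == b)) || ((x == b) && (y == a))).

Lemma add_edge_sym r a b : symmetric r -> symmetric (add_edge r a b).
Proof.
move=> rs x y; rewrite /add_edge rs [in RHS]orbC [in RHS]orbC; congr (_ || _).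
by rewrite orbC; congr (_ || _); exact: andbC.
Qed.

Lemma add_edge_irr r a b : a != b -> irreflexive r -> irreflexive (add_edge r a b).
Proof.
move=> ab ri x; rewrite /add_edge ri /=; case: (eqVneq x a) => [->|_]; rewrite ?(negPf ab) ?andbF //.
Qed.

Lemma adjacent_pairs_add_edge (S : {set T}) r a b : symmetric r ->
  a \in S -> b \in S -> a != b -> ~~ r a b ->
  adjacent_pairs S r + 2 <= adjacent_pairs S (add_edge r a b).
Proof.
move=> rs aS bS ab nr.
have : adjacent_pairs S r + \sum_(x in S) \sum_(y in S) (((x == a) && (y == b)) + ((x == b) && (y == a)))
   <= adjacent_pairs S (add_edge r a b).
  rewrite /adjacent_pairs -big_split /=; apply: leq_sum => x _.
  rewrite /degree_in -big_split /=; apply: leq_sum => y _; rewrite /add_edge.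
  case: (eqVneq x a) => [->|xa].
    rewrite (negPf ab) /=; case: (eqVneq y b) => [->|_]; rewrite ?(negPf nr) //= !addn0 orbF //.
  case: (eqVneq x b) => [->|xb] /=; last by rewrite orbF !addn0.
  by case: (eqVneq y a) => [->|_]; rewrite /= ?(rs b) ?(negPf nr) // orbF !addn0.
apply: leq_trans; rewrite leq_add2l.
under eq_bigr => x _ do rewrite big_split /=.
have one (c d : T) : c \in S -> d \in S -> 1 <= \sum_(x in S) \sum_(y in S) ((x == c) && (y == d)).
  by move=> cS dS; rewrite (big_setD1 c) //= (big_setD1 d) //= !eqxx.
by rewrite big_split /= -[2]/(1 + 1); apply: leq_add; exact: one.
Qed.

End RemoveEdges.

(** * Arcs of a drawing and their common points *)

Section Drawing.
Local Open Scope R_scope.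
Variables (T : finType) (e : rel T) (pos : T -> point) (g : T -> T -> R -> point).
Hypothesis dr : is_drawing e pos g.

Definition edge_arc (x y : T) (q : point) : Prop :=
  exists t : R, (0 <= t <= 1) /\ g x y t = q.

Lemma arc_sym x y q : e x y -> edge_arc x y q -> edge_arc y x q.
Proof.
move=> exy [t [ht <-]]; exists (1 - t); split; first lra.
have [_ [H _]] := dr; have [_ [_ [_ [_ [_ [rev _]]]]]] := H _ _ exy.
by rewrite rev; [congr (g x y); ring|lra].
Qed.

Lemma on_interior_sym x y q : e x y -> on_interior (g x y) q -> on_interior (g y x) q.
Proof.
move=> exy [t [ht <-]]; exists (1 - t); split; first lra.
have [_ [H _]] := dr; have [_ [_ [_ [_ [_ [rev _]]]]]] := H _ _ exy.
by rewrite rev; [congr (g x y); ring|lra].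
Qed.

Lemma edge_path x y : e x y -> planar_path (g x y).
Proof. by move=> exy; have [_ [H _]] := dr; have [c1 [c2 _]] := H _ _ exy; split. Qed.

Lemma edge_start x y : e x y -> g x y 0 = pos x.
Proof. by move=> exy; have [_ [H _]] := dr; have [_ [_ [_ [s _]]]] := H _ _ exy. Qed.

Lemma edge_end x y : e x y -> g x y 1 = pos y.
Proof. by move=> exy; have [_ [H _]] := dr; have [_ [_ [_ [_ [s _]]]]] := H _ _ exy. Qed.

Lemma interior_not_vertex x y q z : e x y -> on_interior (g x y) q -> q <> pos z.
Proof.
move=> exy [t [ht <-]]; have [_ [H _]] := dr; have [_ [_ [_ [_ [_ [_ av]]]]]] := H _ _ exy; exact: av.
Qed.

Lemma joined_arc x y : e x y -> joined (edge_arc x y) (pos x) (pos y).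
Proof.
move=> exy; exists (g x y); split; first exact: edge_path.
by rewrite edge_start // edge_end //; do 2!split => //; move=> t ht; exists t.
Qed.

Lemma arc_cases x y q : e x y -> edge_arc x y q ->
  [\/ q = pos x, q = pos y | on_interior (g x y) q].
Proof.
move=> exy [t [ht E]].
case: (Req_dec t 0) => t0; first by apply: Or31; rewrite -E t0 edge_start.
case: (Req_dec t 1) => t1; first by apply: Or32; rewrite -E t1 edge_end.
by apply: Or33; exists t; split=> //; lra.
Qed.

Lemma arc_vertex x y z : e x y -> edge_arc x y (pos z) -> z = x \/ z = y.
Proof.
move=> exy /(arc_cases exy)[E|E|/(@interior_not_vertex _ _ _ z exy)//]; have [inj _] := dr.
  by left; apply: inj.
by right; apply: inj.
Qed.

Lemma interior_of_arc x y q : e x y -> edge_arc x y q ->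
  (forall z, q <> pos z) -> on_interior (g x y) q.
Proof. by move=> exy /(arc_cases exy)[E|E|//] /(_ _ E). Qed.

(** The common point is no vertex, for an arc contains only the vertices at its ends, and the two
    edges share none. *)
Lemma arcs_meet_inside a b c d q : e a b -> e c d ->
  [&& a != c, a != d, b != c & b != d] -> edge_arc a b q -> edge_arc c d q ->
  on_interior (g a b) q /\ on_interior (g c d) q.
Proof.
move=> eab ecd /and4P[/eqP ac /eqP ad /eqP bc /eqP bd] q1 q2.
have nv z : q <> pos z.
  move=> E; rewrite E in q1 q2.
  by case: (arc_vertex eab q1); case: (arc_vertex ecd q2) => *; subst.
by split; apply: interior_of_arc.
Qed.

(** Three points covering the crossings; they may coincide, and some may be no crossings. *)
Variable X : 'I_3 -> point.
Hypothesis crossX : forall q, is_crossing e g q -> exists m, X m = q.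

Definition through (m : 'I_3) (a b : T) : Prop := on_interior (g a b) (X m).

Lemma through_three m a b c d x y : e a b -> e c d -> e x y ->
  through m a b -> through m c d -> through m x y -> ~ same_edge a b c d ->
  same_edge x y a b \/ same_edge x y c d.
Proof.
move=> eab ecd exy h1 h2 h3 n; have [_ [_ H]] := dr.
case: (H _ _ _ _ _ _ _ eab ecd exy h1 h2 h3) => [//|[]/same_edge_sym]; by [left|right].
Qed.

Lemma independent_not_same (a b c d : T) :
  [&& a != c, a != d, b != c & b != d] -> ~ same_edge a b c d.
Proof. by move=> /and4P[/eqP ac /eqP ad _ _] [[]|[]]. Qed.

Lemma arcs_meet_through a b c d q : e a b -> e c d ->
  [&& a != c, a != d, b != c & b != d] -> edge_arc a b q -> edge_arc c d q ->
  exists m, through m a b /\ through m c d.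
Proof.
move=> eab ecd ind q1 q2; have [h1 h2] := arcs_meet_inside eab ecd ind q1 q2.
have [|m E] := @crossX q; first by exists a, b, c, d; do 3!split=> //; exact: independent_not_same.
by exists m; rewrite /through E.
Qed.

Lemma uncrossed_weakly_planar (S : {set T}) (r : rel T) :
  (forall x y, r x y -> e x y) ->
  (forall m x y z w, r x y -> r z w -> through m x y -> through m z w -> same_edge x y z w) ->
  weakly_planar S r.
Proof.
move=> re unc; exists pos, edge_arc; split; first by move=> x y _ _ /re; exact: joined_arc.
move=> x y z w _ _ _ _ rxy rzw ind q q1 q2.
have [m [h1 h2]] := arcs_meet_through (re _ _ rxy) (re _ _ rzw) ind q1 q2.
exact: independent_not_same ind (unc _ _ _ _ _ rxy rzw h1 h2).
Qed.

(** The arc is cut at [q], short of [y], so that [x] is the only vertex on [B]. *)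
Lemma joined_initial x y q : e x y -> on_interior (g x y) q ->
  exists B : point -> Prop, joined B (pos x) q /\
    forall p, B p -> p = pos x \/ on_interior (g x y) p.
Proof.
move=> exy [t [ht <-]].
exists (fun p => exists u, (Rmin 0 t <= u <= Rmax 0 t) /\ g x y u = p); split.
  by rewrite -(edge_start exy); apply: joined_subpath; exact: edge_path.
move=> p [u [hu <-]]; rewrite Rmin_left ?Rmax_right in hu; try lra.
case: (Req_dec u 0) => u0; first by left; rewrite u0 edge_start.
by right; exists u; split=> //; lra.
Qed.

(* The new edge [ab] follows [ac] up to the crossing and then [bd] back to [b]. *)
Lemma shortcut_weakly_planar (S : {set T}) (r : rel T) m a b c d :
  (forall x y, r x y -> e x y) -> e a c -> e b d -> through m a c -> through m b d ->
  (forall x y, r x y -> ~ same_edge x y b d) ->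
  (forall m' x y z w,
     r x y \/ same_edge x y a c \/ same_edge x y b d ->
     r z w \/ same_edge z w a c \/ same_edge z w b d ->
     e x y -> e z w ->
     through m' x y -> through m' z w ->
     same_edge x y z w \/ (same_edge x y a c /\ same_edge z w b d) \/
     (same_edge x y b d /\ same_edge z w a c)) ->
  weakly_planar S (add_edge r a b).
Proof.
move=> re eac ebd mac mbd rbd unc.
have [B1 [j1 H1]] := joined_initial eac mac.
have [B2 [j2 H2]] := joined_initial ebd mbd.
pose B q := B1 q \/ B2 q.
have jB : joined B (pos a) (pos b).
  apply: joined_trans (joined_sub _ j1) (joined_sub _ (joined_sym j2)) => q; by [left|right].
(* A point shared by the shortcut and [zw] is interior to [ac] or [bd], hence a crossing, even if
   [zw] ends in [c] or [d]. But [zw] is not [ac], as it avoids [a], nor [bd], which [r] lacks; so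
   [unc] excludes it. *)
have disjB z w q : r z w -> [&& a != z, a != w, b != z & b != w] -> B q -> edge_arc z w q -> False.
  move=> rzw /and4P[/eqP az /eqP aw /eqP bz /eqP bw] Bq q2; have ezw := re _ _ rzw.
  have key x y : e x y -> same_edge x y a c \/ same_edge x y b d ->
      x <> z -> x <> w -> (q = pos x \/ on_interior (g x y) q) -> ~ same_edge z w a c -> False.
    move=> exy sxy xz xw hq nzw.
    have {}hq : on_interior (g x y) q.
      by case: hq => // E; rewrite E in q2; case: (arc_vertex ezw q2).
    have hq2 : on_interior (g z w) q.
      by apply: interior_of_arc => // v; exact: interior_not_vertex hq.
    have nsame : ~ same_edge x y z w by move=> [[]|[]].
    have [|m' E] := @crossX q; first by exists x, y, z, w.
    rewrite -/(through m' x y) -E in hq hq2.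
    have [] := unc m' x y z w (or_intror sxy) (or_introl rzw) exy ezw hq hq2 => //.
    by move=> [[_ /(rbd _ _ rzw)]|[_ ]].
  have nac : ~ same_edge z w a c by move=> [[]|[_]] *; [apply: az|apply: aw].
  case: Bq => [/H1|/H2] hq.
    by apply: (key a c) => //; left; left.
  by apply: (key b d) => //; right; left.
exists pos, (fun x y q => if r x y then edge_arc x y q else B q); split.
  move=> x y _ _; rewrite /add_edge; case rxy: (r x y) => /=; first by move=> _; apply/joined_arc/re.
  by move=> /orP[/andP[/eqP-> /eqP->]|/andP[/eqP-> /eqP->]] //; exact: joined_sym.
move=> x y z w _ _ _ _; rewrite /add_edge.
case rxy: (r x y) => /=; case rzw: (r z w) => /=.
- move=> _ _ ind q q1 q2; have [m' [h1 h2]] := arcs_meet_through (re _ _ rxy) (re _ _ rzw) ind q1 q2.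
  case: (unc m' x y z w (or_introl rxy) (or_introl rzw) (re _ _ rxy) (re _ _ rzw) h1 h2).
    exact: independent_not_same.
  by case=> -[]; [move=> _ /(rbd _ _ rzw)|move=> /(rbd _ _ rxy)].
- move=> _ hab /and4P[n1 n2 n3 n4] q q1 q2; apply: (disjB x y q rxy _ q2 q1).
  by case/orP: hab => /andP[/eqP <- /eqP <-]; rewrite !(eq_sym z) !(eq_sym w) ?n1 ?n2 ?n3 ?n4.
- move=> hab _ /and4P[n1 n2 n3 n4] q q1 q2; apply: (disjB z w q rzw _ q1 q2).
  by case/orP: hab => /andP[/eqP <- /eqP <-]; rewrite ?n1 ?n2 ?n3 ?n4.
- move=> /orP[/andP[/eqP-> /eqP->]|/andP[/eqP-> /eqP->]] /orP[/andP[/eqP-> /eqP->]|/andP[/eqP-> /eqP->]];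
  by rewrite !eqxx ?andbF.
Qed.

End Drawing.

(** * Kempe chains *)

Section Kempe.
Variables (T : finType) (e : rel T).
Hypotheses (e_sym : symmetric e) (e_irr : irreflexive e).

Definition proper_on (k : nat) (S : {set T}) (c : T -> 'I_k) : Prop :=
  forall x y, x \in S -> y \in S -> e x y -> c x != c y.

Definition colorable_on (k : nat) (S : {set T}) : Prop :=
  exists c : T -> 'I_k, proper_on S c.

Lemma extend_coloring k (S : {set T}) v (c : T -> 'I_k) i :
  proper_on (S :\ v) c -> (forall x, x \in S -> e v x -> c x != i) -> colorable_on k S.
Proof.
move=> cP free; exists (fun x => if x == v then i else c x) => x y xS yS exy.
case: (eqVneq x v) => [xv|xv]; case: (eqVneq y v) => [yv|yv].
- by rewrite xv yv e_irr in exy.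
- by rewrite eq_sym; apply: free => //; rewrite -xv.
- by apply: free => //; rewrite e_sym -yv.
- by apply: cP => //; rewrite !inE ?xv ?yv.
Qed.

Lemma noncolorable_degree k (S : {set T}) v :
  ~ colorable_on k S -> colorable_on k (S :\ v) -> k <= degree_in S e v.
Proof.
move=> nS [c cP]; rewrite degree_inE leqNgt; apply/negP => lt; apply: nS.
have [i iN] : exists i, i \notin c @: [set y in S | e v y].
  apply/existsP; apply: contraT; rewrite negb_exists => /forallP H.
  have : [set: 'I_k] \subset c @: [set y in S | e v y].
    by apply/subsetP => i _; have := H i; rewrite negbK.
  move=> /subset_leq_card; rewrite cardsT card_ord => /leq_trans/(_ (leq_imset_card _ _)).
  by rewrite leqNgt lt.
apply: (extend_coloring (i := i) cP) => x xS evx; apply: contraNneq iN => <-.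
by apply: imset_f; rewrite inE xS.
Qed.

Definition bicolored (k : nat) (S : {set T}) (c : T -> 'I_k) (i j : 'I_k) : rel T :=
  fun x y => [&& x \in S, y \in S, e x y &
    ((c x == i) && (c y == j)) || ((c x == j) && (c y == i))].

Lemma bicolored_sym k S (c : T -> 'I_k) i j : symmetric (bicolored S c i j).
Proof.
move=> x y; rewrite /bicolored e_sym; case: (x \in S); case: (y \in S) => //=.
by rewrite orbC ![(c y == _) && _]andbC.
Qed.

(** Every color occurs among the [k] neighbors, hence exactly once. If the chain of [nb i] missed
    [nb j], swapping [i] and [j] on it would free [i] for [v]. *)
Lemma kempe_chains k (S : {set T}) v (c : T -> 'I_k) :
  ~ colorable_on k S -> proper_on (S :\ v) c -> degree_in S e v = k ->
  exists nb : 'I_k -> T,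
    (forall i, [/\ nb i \in S, e v (nb i) & c (nb i) = i]) /\
    forall i j, i != j -> connect (bicolored (S :\ v) c i j) (nb i) (nb j).
Proof.
move=> nS cP dv; set N := [set y in S | e v y].
have cN : #|N| = k by rewrite -dv degree_inE.
have nbex i : exists x, (x \in N) && (c x == i).
  apply: NNPP => H; apply: nS; apply: (extend_coloring (i := i) cP) => x xS evx.
  by apply/eqP => E; apply: H; exists x; rewrite inE xS evx E eqxx.
pose nb i := xchoose (nbex i).
have nbP i : nb i \in N /\ c (nb i) = i.
  by have /andP[? /eqP] := xchooseP (nbex i).
have cinj : {in N &, injective c}.
  apply/imset_injP; rewrite eqn_leq leq_imset_card /= cN -[X in X <= _]card_ord -cardsT.
  by apply: subset_leq_card; apply/subsetP => i _; have [h <-] := nbP i; apply: imset_f.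
exists nb; split=> [i|i j ij]; first by have [+ E] := nbP i; rewrite inE => /andP[].
apply: contraT => nconn; case: nS.
set R := bicolored (S :\ v) c i j in nconn.
have Rsym : connect_sym R by apply: sym_connect_sym; exact: bicolored_sym.
have comp_col x : connect R (nb i) x -> c x = i \/ c x = j.
  case/connectP=> p; case/lastP: p => [_ ->|p y]; first by left; case: (nbP i).
  rewrite rcons_path last_rcons => /andP[_ +] ->; rewrite /R /bicolored => /and4P[_ _ _].
  by case/orP=> /andP[_ /eqP]; [right|left].
pose c' x := if connect R (nb i) x then tperm i j (c x) else c x.
(* An edge leaving the chain has its outer end colored neither [i] nor [j]. *)
have mixed x y : x \in S :\ v -> y \in S :\ v -> e x y ->
    connect R (nb i) x -> ~~ connect R (nb i) y -> c' x != c' y.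
  move=> xS yS exy cx ncy; rewrite /c' cx (negPf ncy).
  have nRxy : ~~ R x y by apply: contraNN ncy => Rxy; apply: connect_trans cx (connect1 Rxy).
  have cxy := cP x y xS yS exy.
  have [cyi cyj] : c y != i /\ c y != j.
    by split; apply: contraNneq nRxy => E; move: cxy; rewrite /R /bicolored xS yS exy /= E;
      case: (comp_col x cx) => ->; rewrite !eqxx ?orbT.
  by case: (comp_col x cx) => ->; rewrite ?tpermL ?tpermR eq_sym.
apply: (@extend_coloring k S v c' i) => [x y xS yS exy|x xS evx].
  case: (boolP (connect R (nb i) x)) => cx; case: (boolP (connect R (nb i) y)) => cy.
  - by rewrite /c' cx cy (inj_eq perm_inj); exact: cP.
  - exact: mixed.
  - by rewrite eq_sym; apply: mixed => //; rewrite e_sym.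
  - by rewrite /c' (negPf cx) (negPf cy); exact: cP.
have xN : x \in N by rewrite inE xS.
rewrite /c'; case: (boolP (connect R (nb i) x)) => cx.
  apply: contraNneq nconn => E; suff <- : x = nb j by [].
  apply: cinj => //; first by case: (nbP j).
  by rewrite (proj2 (nbP j)) -[LHS](tpermK i j) E tpermL.
apply: contraNneq cx => E; suff -> : x = nb i by exact: connect0.
by apply: cinj => //; case: (nbP i) => // _ ->.
Qed.

End Kempe.

(** * Minimal sets without a 5-coloring *)

Section CriticalSet.
Variables (T : finType) (e : rel T) (pos : T -> point) (g : T -> T -> R -> point).
Hypotheses (e_sym : symmetric e) (e_irr : irreflexive e) (dr : is_drawing e pos g).
Variable X : 'I_3 -> point.
Hypothesis crossX : forall q, is_crossing e g q -> exists m, X m = q.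
Variable S : {set T}.
Hypothesis nS : ~ colorable_on e 5 S.
Hypothesis minS : forall v, v \in S -> colorable_on e 5 (S :\ v).

Notation through := (through g X).

Lemma critical_degree v : v \in S -> 5 <= degree_in S e v.
Proof. by move=> vS; apply: noncolorable_degree (minS vS). Qed.

Lemma critical_card : 6 <= #|S|.
Proof.
have [v vS] : exists v, v \in S.
  apply: NNPP => H; apply: nS; exists (fun=> ord0) => x y xS; by case: H; exists x.
by have := critical_degree vS; have := degree_in_lt e_irr vS; lia.
Qed.

(** For each [m] an edge [F m] is chosen so that any two distinct edges through [X m] include it.
    Without these three edges the graph is weakly planar, and restoring them adds at most 6 adjacent
    pairs. *)
Lemma critical_pairs_le : adjacent_pairs S e + 6 <= 6 * #|S|.
Proof.
have /card_gt0P[v0 _] : 0 < #|S| by have := critical_card; lia.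
have [F FP] : exists F : 'I_3 -> T * T, forall m x y z w, e x y -> e z w ->
    through m x y -> through m z w ->
    same_edge x y z w \/ same_edge x y (F m).1 (F m).2 \/ same_edge z w (F m).1 (F m).2.
  apply: (@fin_all_exists 'I_3 (fun=> (T * T)%type) (fun m F => forall x y z w, e x y -> e z w ->
    through m x y -> through m z w ->
    same_edge x y z w \/ same_edge x y F.1 F.2 \/ same_edge z w F.1 F.2)) => m.
  case: (classic (exists a b c d, [/\ e a b, e c d, through m a b, through m c d & ~ same_edge a b c d])).
    move=> [a [b [c [d [eab ecd h1 h2 n]]]]]; exists (a, b) => x y z w exy ezw t1 t2 /=.
    case: (through_three dr eab ecd exy h1 h2 t1 n); first by right; left.
    case: (through_three dr eab ecd ezw h1 h2 t2 n); first by right; right.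
    by move=> /same_edge_sym s1 s2; left; apply: same_edge_trans s2 s1.
  (* With at most one edge through [X m], the loop at [v0] is a default whose removal changes
     nothing. *)
  move=> H; exists (v0, v0) => x y z w exy ezw t1 t2; left; apply: NNPP => n.
  by apply: H; exists x, y, z, w.
pose r := remove_edges e [seq F m | m <- enum 'I_3].
have rP x y m : r x y -> e x y /\ ~ same_edge x y (F m).1 (F m).2.
  by move=> /remove_edgesP[exy H]; split=> //; apply: H; apply: map_f; rewrite mem_enum.
have wp : weakly_planar S r.
  apply: (uncrossed_weakly_planar dr crossX) => [x y /(rP _ _ ord0)[]//|m x y z w].
  move=> /(rP _ _ m)[exy nxy] /(rP _ _ m)[ezw nzw] t1 t2.
  by case: (FP m x y z w exy ezw t1 t2) => [//|[]].
have := adjacent_pairs_remove_edges S e [seq F m | m <- enum 'I_3].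
have := weakly_planar_edge_bound (remove_edges_sym _ e_sym) (remove_edges_irr _ e_irr) wp.
by have := critical_card; rewrite size_map size_enum_ord -/r; lia.
Qed.

Definition ends (m : 'I_3) : {set T} :=
  [set z in S | [exists w in S, e z w &&
     (if excluded_middle_informative (through m z w) then true else false)]].

(** In contrast to [is_crossing], the two edges are disjoint and lie within [S]. *)
Definition crossing (m : 'I_3) (a b c d : T) : Prop :=
  [/\ uniq [:: a; b; c; d], {subset [:: a; b; c; d] <= S}, e a b, e c d &
      through m a b /\ through m c d].

Lemma crossing_not_same m a b c d : crossing m a b c d -> ~ same_edge a b c d.
Proof.
move=> [us _ _ _ _] s; move: us; rewrite /= !inE !negb_or.
by case: s => [[-> ->]|[-> ->]]; rewrite !eqxx ?andbF.
Qed.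

Lemma crossing_through m a b c d x y : crossing m a b c d -> e x y -> through m x y ->
  same_edge x y a b \/ same_edge x y c d.
Proof.
move=> cr exy t; have n := crossing_not_same cr.
have [_ _ eab ecd [t1 t2]] := cr; exact: (through_three dr eab ecd exy t1 t2 t n).
Qed.

Lemma endsE m a b c d : crossing m a b c d -> ends m =i [:: a; b; c; d].
Proof.
move=> cr; have [us sS eab ecd [t1 t2]] := cr.
have endI x y : x \in S -> y \in S -> e x y -> through m x y -> x \in ends m.
  move=> xS yS exy t; rewrite inE xS; apply/exists_inP; exists y => //.
  by rewrite exy; case: excluded_middle_informative.
move=> z; apply/idP/idP.
  rewrite inE => /andP[zS /exists_inP[w wS /andP[ezw]]].
  case: excluded_middle_informative => // t _; rewrite !inE.
  by case: (crossing_through cr ezw t) => [[[-> _]|[-> _]]|[[-> _]|[-> _]]]; rewrite eqxx ?orbT.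
have [aS bS cS dS] : [/\ a \in S, b \in S, c \in S & d \in S].
  by split; apply: sS; rewrite !inE eqxx ?orbT.
rewrite !in_cons in_nil orbF => /or4P[]/eqP->.
- exact: (endI a b).
- by apply: (endI b a) => //; [rewrite e_sym|exact: (on_interior_sym dr)].
- exact: (endI c d).
- by apply: (endI d c) => //; [rewrite e_sym|exact: (on_interior_sym dr)].
Qed.

Lemma card_ends m a b c d : crossing m a b c d -> #|ends m| = 4.
Proof. by move=> cr; rewrite (eq_card (endsE cr)); have [/card_uniqP-> _ _ _ _] := cr. Qed.

(* [v] together with its five neighbours and the Kempe chains is a drawing of K6. *)
Lemma kempe_crossings v : v \in S -> degree_in S e v = 5 ->
  exists col : T -> 'I_6,
    (forall x, x \in S -> col x = ord_max -> x = v) /\ col v = ord_max /\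
    forall k, exists m a b c d, crossing m a b c d /\
      uniq [seq col x | x <- [:: a; b; c; d]] /\ k \notin [seq col x | x <- [:: a; b; c; d]].
Proof.
move=> vS dv; have [c cP] := minS vS.
have [nb [nbP chain]] := kempe_chains e_sym e_irr nS cP dv.
pose col x : 'I_6 := if x == v then ord_max else lift ord_max (c x).
pose p (i : 'I_6) := if unlift ord_max i is Some j then nb j else v.
(* [A i j] gathers the edges of G[S] with ends colored [i] and [j], so disjoint pairs of colors give
   disjoint edges. *)
pose A i j q := exists a b, [/\ a \in S, b \in S, e a b, col a = i /\ col b = j & edge_arc g a b q].
have colN x : x != v -> col x = lift ord_max (c x) by rewrite /col => /negPf->.
have colv : col v = ord_max by rewrite /col eqxx.
have nbv i : nb i != v by have [_ evn _] := nbP i; apply: contraTneq evn => ->; rewrite e_irr.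
exists col; split; first by move=> x _; rewrite /col; case: eqP => // _ /eqP; rewrite eq_sym (negPf (neq_lift _ _)).
split=> //.
have spoke i j : i = ord_max -> j != ord_max -> joined (A i j) (pos (p i)) (pos (p j)).
  move=> ->; rewrite {1}/p unlift_none /p; case: unliftP => [j' -> _|->]; last by rewrite eqxx.
  have [nS' evn cn] := nbP j'.
  apply: joined_sub (joined_arc dr evn) => q qa; exists v, (nb j'); split=> //.
  by rewrite colv colN // cn.
have symA i j : joined (A i j) (pos (p i)) (pos (p j)) -> joined (A j i) (pos (p j)) (pos (p i)).
  move=> /joined_sym; apply: joined_sub => q [a [b [aS bS eab [ca cb] qa]]].
  by exists b, a; split=> //; [rewrite e_sym|exact: (arc_sym dr)].
have joinA i j : i != j -> joined (A i j) (pos (p i)) (pos (p j)).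
  case: (unliftP ord_max i) => [i' Ei|Ei]; last by move=> ij; apply: spoke; rewrite // eq_sym -Ei.
  case: (unliftP ord_max j) => [j' Ej|Ej]; last by move=> ij; apply/symA/spoke; rewrite // -Ej.
  rewrite Ei Ej (inj_eq lift_inj) /p !liftK => ij.
  have /connectP[s sP sl] := chain _ _ ij.
  have step x y : bicolored e (S :\ v) c i' j' x y ->
      joined (A (lift ord_max i') (lift ord_max j')) (pos x) (pos y).
    rewrite /bicolored !in_setD1 => /and4P[/andP[xv xS] /andP[yv yS] exy cxy].
    apply: joined_sub (joined_arc dr exy) => q qa.
    case/orP: cxy => /andP[/eqP cx /eqP cy].
      by exists x, y; split=> //; rewrite !colN // cx cy.
    by exists y, x; split; rewrite 1?e_sym ?colN ?cx ?cy //; exact: (arc_sym dr).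
  have walk s' : forall x, path (bicolored e (S :\ v) c i' j') x s' -> s' <> [::] ->
      joined (A (lift ord_max i') (lift ord_max j')) (pos x) (pos (last x s')).
    elim: s' => // y [|z s'] IH x /= /andP[xy ps] _; first exact: step.
    by apply: joined_trans (step _ _ xy) _; exact: IH.
  rewrite sl; apply: walk sP _ => s0; move: sl; rewrite s0 /= => E.
  by have [_ _] := nbP j'; have [_ _] := nbP i'; rewrite E => -> ji; rewrite ji eqxx in ij.
(* Omitting [k] leaves a K5 on the indices [lift k i], so the four colors at its crossing differ
   from [k]. *)
move=> k; have [i j ij|i [j [i' [j' [[ij ij' ii' ij2 ji'] [jj' [q [qA qA']]]]]]]] :=
   @K5_meets (fun i => pos (p (lift k i))) (fun i j => A (lift k i) (lift k j)).
  by apply: joinA; rewrite (inj_eq lift_inj) -val_eqE neq_ltn ij.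
have [a [b [aS bS eab [ca cb] qab]]] := qA; have [a' [b' [aS' bS' eab' [ca' cb'] qab']]] := qA'.
have ucol : uniq [seq col x | x <- [:: a; b; a'; b']].
  by rewrite /= ca cb ca' cb' !inE !(inj_eq lift_inj) !negb_or ii' ij2 ji' jj' -!val_eqE /= !neq_ltn ij ij'.
have us := map_uniq ucol.
have ind : [&& a != a', a != b', b != a' & b != b'].
  by move: us; rewrite /= !inE !negb_or !andbT => /and3P[/and3P[_ -> ->] /andP[-> ->] _].
have [m [h1 h2]] := arcs_meet_through dr crossX eab eab' ind qab qab'.
exists m, a, b, a', b'; split; last split=> //.
  by split=> // x; rewrite !inE => /or4P[]/eqP->.
by rewrite /= ca cb ca' cb' !inE !negb_or !neq_lift.
Qed.

(* Each of the six K5's in that K6 contains a crossing, and a crossing, having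
   ends of four colours, lies in only two of them. *)
Lemma degree5_crossings v : v \in S -> degree_in S e v = 5 ->
  [/\ forall m, exists a b c d, crossing m a b c d,
      injective ends & #|[set m | v \in ends m]| = 2].
Proof.
move=> vS dv; have [col [colmax [colv colX]]] := kempe_crossings vS dv.
have [W WP] := fin_all_exists colX.
have inW k m : W k = m -> k \notin col @: ends m /\ #|col @: ends m| = 4 /\
    exists a b c d, crossing m a b c d.
  move=> <-; have [a [b [c [d [cr [uc kc]]]]]] := WP k.
  have E : col @: ends (W k) =i [seq col x | x <- [:: a; b; c; d]].
    move=> y; apply/imsetP/mapP => -[x xe ->]; exists x => //.
      by rewrite -(endsE cr).
    by rewrite (endsE cr).
  split; first by rewrite E.
  by split; [rewrite (eq_card E); exact/card_uniqP|exists a, b, c, d].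
(* The indices served by [m] are among the two colors missing at its ends. As three crossings serve
   six indices, each serves exactly these two. *)
pose fib m := [set k | W k == m].
have fibS m : fib m \subset ~: (col @: ends m).
  by apply/subsetP => k; rewrite inE => /eqP/inW[kn _]; rewrite inE.
have fib2 m : #|fib m| <= 2.
  have [->|[k]] := set_0Vmem (fib m); first by rewrite cards0.
  rewrite inE => /eqP/inW[_ [c4 _]]; apply: leq_trans (subset_leq_card (fibS m)) _.
  by rewrite cardsCs setCK card_ord c4.
have fib6 : \sum_m #|fib m| = 6.
  rewrite -[RHS]card_ord -sum1_card (partition_big W predT) //=.
  by apply: eq_bigr => m _; rewrite -sum1_card; apply: eq_bigl => k; rewrite inE.
have fibE2 m : #|fib m| = 2.
  apply/eqP; rewrite eqn_leq fib2 /=; move: fib6; rewrite (bigD1 m) //=.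
  have : \sum_(i < 3 | i != m) #|fib i| <= \sum_(i < 3 | i != m) 2 by apply: leq_sum.
  by rewrite sum_nat_const cardC1 card_ord; set s := \sum_(i < 3 | _) _; lia.
have fibX m : exists2 k, W k = m & k \in fib m.
  have /card_gt0P[k kf] : 0 < #|fib m| by rewrite fibE2.
  by exists k => //; move: kf; rewrite inE => /eqP.
have fibE m : fib m = ~: (col @: ends m).
  apply/eqP; rewrite eqEcard fibS /= fibE2 cardsCs setCK card_ord.
  by have [k /inW[_ [-> _]] _] := fibX m.
split.
- by move=> m; have [k /inW[_ [_ H]] _] := fibX m.
(* Fibers are nonempty and determined by the ends, so equal ends give a common [k], and [W k] is
   both [m] and [m']. *)
- move=> m m' E; have [k Wk kf] := fibX m.
  by move: kf; rewrite fibE E -fibE inE Wk => /eqP.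
(* As only [v] has the color [ord_max] in [S], it is an end of [m] unless [m] serves [ord_max]. *)
have -> : [set m | v \in ends m] = [set~ W ord_max].
  apply/setP => m; rewrite in_set in_setC1.
  have -> : (v \in ends m) = (ord_max \in col @: ends m).
    apply/idP/imsetP => [vm|[x xm E]]; first by exists v.
    rewrite -(colmax x) //; by move: xm; rewrite inE => /andP[].
  by rewrite -[_ \in col @: _]negbK -in_setC -fibE inE eq_sym.
by rewrite cardsC1 card_ord.
Qed.

Lemma crossing_swap m a b c d : crossing m a b c d -> crossing m c d a b.
Proof.
move=> [us sS eab ecd [t1 t2]].
have pe : perm_eq [:: c; d; a; b] [:: a; b; c; d].
  exact: (permEl (perm_catC [:: c; d] [:: a; b])).
by split=> //; [rewrite (perm_uniq pe)|move=> x; rewrite (perm_mem pe) => /sS].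
Qed.

Lemma crossing_flip m a b c d : crossing m a b c d -> crossing m b a c d.
Proof.
move=> [us sS eab ecd [t1 t2]].
have pe : perm_eq [:: b; a; c; d] [:: a; b; c; d].
  exact: (permEl (perm_catCA [:: b] [:: a] [:: c; d])).
split=> //; first by rewrite (perm_uniq pe).
- by move=> x; rewrite (perm_mem pe) => /sS.
- by rewrite e_sym.
- by split=> //; exact: (on_interior_sym dr).
Qed.

(** If [a] and [c] were not adjacent, removing three edges, among them [cd], and adding [ac] along
    [ab] and [cd] would leave at least 6|S| - 6 - 6 + 2 adjacent pairs, above the bound 6|S| -
    12. *)
Lemma crossing_adjacent m a b c d :
  (forall m, exists a b c d, crossing m a b c d) -> injective ends ->
  6 * #|S| <= adjacent_pairs S e + 6 -> crossing m a b c d -> e a c.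
Proof.
move=> crX ends_inj many cr; apply: contraT => nac.
have [us sS eab ecd [t1 t2]] := cr.
(* At the other crossings the removed edge is neither [ab] nor [cd], so that the shortcut meets no
   remaining edge there. *)
have [F FP] : exists F : 'I_3 -> T * T, forall m',
    (m' = m -> F m' = (c, d)) /\
    (m' <> m -> [/\ ~ same_edge (F m').1 (F m').2 a b, ~ same_edge (F m').1 (F m').2 c d &
      forall x y z w, e x y -> e z w -> through m' x y -> through m' z w ->
      same_edge x y z w \/ same_edge x y (F m').1 (F m').2 \/ same_edge z w (F m').1 (F m').2]).
  apply: (@fin_all_exists 'I_3 (fun=> (T * T)%type) (fun m' F =>
    (m' = m -> F = (c, d)) /\
    (m' <> m -> [/\ ~ same_edge F.1 F.2 a b, ~ same_edge F.1 F.2 c d &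
      forall x y z w, e x y -> e z w -> through m' x y -> through m' z w ->
      same_edge x y z w \/ same_edge x y F.1 F.2 \/ same_edge z w F.1 F.2]))) => m'.
  case: (eqVneq m' m) => [mm|/eqP mm]; first by exists (c, d); split.
  have key a' b' c' d' : crossing m' a' b' c' d' ->
      ~ (same_edge a' b' a b \/ same_edge a' b' c d) -> exists F : T * T,
      (m' = m -> F = (c, d)) /\
    (m' <> m -> [/\ ~ same_edge F.1 F.2 a b, ~ same_edge F.1 F.2 c d &
      forall x y z w, e x y -> e z w -> through m' x y -> through m' z w ->
      same_edge x y z w \/ same_edge x y F.1 F.2 \/ same_edge z w F.1 F.2]).
    move=> cr' n; exists (a', b'); split=> // _; split=> [s|s|x y z w exy ezw h1 h2].
    - by apply: n; left.
    - by apply: n; right.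
    case: (crossing_through cr' exy h1); first by right; left.
    case: (crossing_through cr' ezw h2); first by right; right.
    by move=> /same_edge_sym s1 s2; left; apply: same_edge_trans s2 s1.
  have [a' [b' [c' [d' cr']]]] := crX m'.
  case: (classic (same_edge a' b' a b \/ same_edge a' b' c d)) => [s1|]; last exact: key cr'.
  case: (classic (same_edge c' d' a b \/ same_edge c' d' c d)) => [s2|]; last exact: key (crossing_swap cr').
  (* Otherwise the edges at [m'] are [ab] and [cd] again, with the same ends. *)
  case: mm; apply: ends_inj; apply/setP => z; rewrite (endsE cr) (endsE cr') !inE.
  have n' := crossing_not_same cr'.
  have both u w : same_edge a' b' u w -> same_edge c' d' u w -> False.
    by move=> h1 /same_edge_sym h2; apply: n'; apply: same_edge_trans h1 h2.
  have eqs x y u w : same_edge x y u w -> (z == x) || (z == y) = (z == u) || (z == w).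
    by case=> -[-> ->] //; rewrite orbC.
  rewrite !orbA -(orbA (_ || _)) -[RHS](orbA (_ || _)).
  by case: s1 => s1; case: s2 => s2; [case: (both _ _ s1 s2)|idtac|idtac|case: (both _ _ s1 s2)];
    rewrite (eqs _ _ _ _ s1) (eqs _ _ _ _ s2) // orbC.
pose r := remove_edges e [seq F m' | m' <- enum 'I_3].
have rP x y m' : r x y -> e x y /\ ~ same_edge x y (F m').1 (F m').2.
  by move=> /remove_edgesP[exy H]; split=> //; apply: H; apply: map_f; rewrite mem_enum.
have wp : weakly_planar S (add_edge r a c).
  apply: (shortcut_weakly_planar dr crossX _ _ eab ecd t1 t2) => [x y /(rP _ _ ord0)[]//|x y|].
    by move=> /(rP _ _ m)[_]; rewrite (proj1 (FP m)).
  move=> m' x y z w hxy hzw exy ezw h1 h2.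
  case: (eqVneq m' m) => [mm|/eqP mm].
    rewrite mm in h1 h2.
    case: (crossing_through cr exy h1) => s1; case: (crossing_through cr ezw h2) => s2.
    - by left; apply: same_edge_trans s1 (same_edge_sym s2).
    - by right; left.
    - by right; right.
    - by left; apply: same_edge_trans s1 (same_edge_sym s2).
  have [n1 n2 cov] := proj2 (FP m') mm.
  have no u w' : r u w' \/ same_edge u w' a b \/ same_edge u w' c d ->
      ~ same_edge u w' (F m').1 (F m').2.
    case=> [/(rP _ _ m')[]//|[]s /same_edge_sym s']; [apply: n1|apply: n2];
    exact: same_edge_trans s' s.
  by case: (cov x y z w exy ezw h1 h2) => [|[/no|/no]] //; left.
have [aS cS] : a \in S /\ c \in S by split; apply: sS; rewrite !inE eqxx ?orbT.
have ac : a != c by move: us; rewrite /= !inE !negb_or => /and3P[/and3P[]].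
have rs : symmetric r := remove_edges_sym _ e_sym.
have nr : ~~ r a c by apply: contraNN nac => /(rP _ _ m)[].
have := adjacent_pairs_add_edge rs aS cS ac nr.
have := adjacent_pairs_remove_edges S e [seq F m | m <- enum 'I_3].
have := weakly_planar_edge_bound (add_edge_sym a c rs) (add_edge_irr ac (remove_edges_irr _ e_irr)) wp.
by have := critical_card; rewrite size_map size_enum_ord -/r; lia.
Qed.

Lemma critical_K6 : exists D : {set T}, #|D| = 6 /\ {in D &, forall x y, x != y -> e x y}.
Proof.
pose D := [set v in S | degree_in S e v == 5].
have many : 6 * #|S| <= adjacent_pairs S e + #|D|.
  have -> : #|D| = \sum_(v in S) (degree_in S e v == 5).
    rewrite -sum1_card big_mkcond [RHS]big_mkcond /=; apply: eq_bigr => v _.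
    by rewrite inE; case: (v \in S) => //=; case: (_ == 5).
  rewrite -big_split /= mulnC -sum_nat_const; apply: leq_sum => v vS.
  by have := critical_degree vS; case: eqP => /=; lia.
have D6 : 6 <= #|D| by have := critical_pairs_le; lia.
have inD v : v \in D -> v \in S /\ degree_in S e v = 5 by rewrite inE => /andP[? /eqP].
have /card_gt0P[v0 v0D] : 0 < #|D| by lia.
have [crX ends_inj _] := degree5_crossings (proj1 (inD _ v0D)) (proj2 (inD _ v0D)).
have two v : v \in D -> #|[set m | v \in ends m]| = 2.
  by move=> /inD[vS dv]; have [] := degree5_crossings vS dv.
(* Three crossings have 12 ends in all, and each vertex of [D] is counted twice among them. *)
have D6' : #|D| = 6.
  apply/eqP; rewrite eqn_leq D6 andbT -(@leq_pmul2l 2) //.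
  have -> : 2 * 6 = \sum_(m < 3) #|ends m|.
    rewrite (eq_bigr (fun=> 4)) ?sum_nat_const ?card_ord // => m _.
    by have [a [b [c [d /card_ends]]]] := crX m.
  have -> : \sum_(m < 3) #|ends m| = \sum_v \sum_(m < 3) (v \in ends m).
    rewrite exchange_big; apply: eq_bigr => m _ /=.
    by rewrite -sum1_card big_mkcond /=; apply: eq_bigr => v _; case: (v \in _).
  rewrite mulnC -sum_nat_const big_mkcond /=; apply: leq_sum => v _.
  case: ifP => // /two vD; rewrite -[X in X <= _]vD -sum1_card big_mkcond /=.
  by apply: leq_sum => m _; rewrite inE; case: (v \in _).
exists D; split=> // x y xD yD xy.
(* Two sets of two crossings out of three intersect. *)
have [m] : exists m, m \in [set m | x \in ends m] :&: [set m | y \in ends m].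
  apply/card_gt0P; have := cardsUI [set m | x \in ends m] [set m | y \in ends m].
  have := subset_leq_card (subsetT ([set m | x \in ends m] :|: [set m | y \in ends m])).
  by rewrite cardsT card_ord !two //; lia.
rewrite in_setI 2!inE => /andP[xm ym].
have [a [b [c [d cr]]]] := crX m.
have adj a' b' c' d' : crossing m a' b' c' d' -> e a' c'.
  by apply: crossing_adjacent => //; move: many; rewrite D6'.
have cr1 := crossing_flip cr.
have [cr2 cr3] := (crossing_flip (crossing_swap cr), crossing_flip (crossing_swap cr1)).
have [_ _ eab ecd _] := cr.
have [eac ebc] := (adj _ _ _ _ cr, adj _ _ _ _ cr1).
have [eda edb] := (adj _ _ _ _ cr2, adj _ _ _ _ cr3).
move: xm ym xy; rewrite !(endsE cr) !inE => /or4P[]/eqP-> /or4P[]/eqP->; by rewrite ?eqxx // e_sym.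
Qed.

End CriticalSet.

Theorem theorem3p1 (T : finType) (e : rel T)
  (e_sym : symmetric e) (e_irr : irreflexive e)
  (Hnu : crossing_number_le e 3) (Homega : clique_number_le e 5) :
  colorable e 5.
Proof.
have [pos [g [dr [l [/leP ll lP]]]]] := Hnu.
(* The default point fills up a list of fewer than three points. *)
pose X (m : 'I_3) := List.nth m l (R0, R0).
have crossX q : is_crossing e g q -> exists m, X m = q.
  move=> /lP/(In_nth _ _ (R0, R0))[n [/ltP nl <-]].
  by exists (Ordinal (leq_trans nl ll)).
suff all_S (S : {set T}) : colorable_on e 5 S.
  by have [c cP] := all_S [set: T]; exists c => x y; apply: cP; rewrite inE.
have [n] := ubnP #|S|; elim: n S => // n IHn S; rewrite ltnS => Sn.
apply: NNPP => nS.
have minS v : v \in S -> colorable_on e 5 (S :\ v).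
  by move=> vS; apply: IHn; move: Sn; rewrite (cardsD1 v) vS.
have [D [D6 Dadj]] := critical_K6 e_sym e_irr dr crossX nS minS.
apply: (Homega (fun i => enum_val (cast_ord (esym D6) i))).
  by move=> i j /enum_val_inj/cast_ord_inj.
move=> i j ij; apply: Dadj; rewrite ?enum_valP //.
by rewrite (inj_eq enum_val_inj) (inj_eq (@cast_ord_inj _ _ _)).
Qed.
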